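(* Let $\mathsf{N}_n$ be a uniformly random simplex tree-child network with $n$ taxa. For every fixed $R\ge0$ and every finite rooted directed marked graph $G$, the following convergences in probability hold as $n\to\infty$ (a ratio whose denominator is zero being defined as $0$): $$\frac{\#\{u\in V(\mathsf{N}_n):u\text{ is a tree vertex and }U_R(\mathsf{N}_n,u)\cong G\}}{\#\{\text{tree vertices of }\mathsf{N}_n\}}\ \xrightarrow{p}\ \mathbb{P}\bigl(U_R(\hat{\mathcal{L}},p_0)\cong G\bigr),$$ $$\frac{\#\{u\in V(\mathsf{N}_n):u\text{ is a reticulation vertex and }U_R(\mathsf{N}_n,u)\cong G\}}{\#\{\text{reticulation vertices of }\mathsf{N}_n\}}\ \xrightarrow{p}\ \mathbb{P}\bigl(U_R(\hat{\mathcal{R}},\rho_0)\cong G\bigr),$$ $$\frac{\#\{u\in V(\mathsf{N}_n):u\text{ is a leaf and }U_R(\mathsf{N}_n,u)\cong G\}}{\#\{\text{leaves of }\mathsf{N}_n\}}\ \xrightarrow{p}\ \mathbb{P}\bigl(U_R(\hat{\mathsf{N}}^{\mathrm{lf}},\ell_0)\cong G\bigr).$$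
   Context: A simplex tree-child network on a finite set $X$ is a finite directed acyclic graph $N=(V,E)$ with a root $o$ and with leaves bijectively labelled by $X$, such that: the root has (indegree, outdegree) $=(0,1)$; every vertex is reachable from $o$ by a directed path; every leaf has degree $(1,0)$; every vertex that is neither the root nor a leaf is either a tree vertex, of degree $(1,2)$, or a reticulation vertex, of degree $(2,1)$; (tree-child) every non-leaf vertex has at least one child that is a tree vertex or a leaf; (one-component) the unique child of every reticulation vertex is a leaf. Networks are considered up to isomorphism preserving leaf labels. $\mathsf{N}_n$ is uniform on the finite set of simplex tree-child networks with leaf label set $[n]$. Local neighbourhoods: for a directed graph $N$ and $v\in V(N)$, $U_R(N,v)$ is the subgraph induced by the vertices at undirected graph distance at most $R$ from $v$, rooted at $v$. Each vertex carries a mark giving its type in $N$ (root, tree vertex, reticulation, or leaf); leaf labels are ignored. $\cong$ denotes isomorphism of rooted directed marked graphs, i.e. a bijection of vertex sets preserving root, marks, edges and edge orientations. Limit networks (deterministic, so the limiting probabilities are $0$ or $1$). A bi-infinite spine is a bi-infinite directed path $\cdots\to x_{-1}\to x_0\to x_1\to\cdots$ of tree vertices. To decorate a tree vertex $x$ means: give $x$ a new reticulation child $\rho(x)$; give $\rho(x)$ a new leaf child $\ell(x)$; and give $\rho(x)$ a second parent $w(x)$, which is a tree vertex on a new bi-infinite spine, all of whose vertices other than $w(x)$ are in turn decorated, recursively (the reticulation child of $w(x)$ is $\rho(x)$). All spines and vertices introduced at every level are pairwise distinct. - $\hat{\mathcal{L}}$ is a bi-infinite spine $\cdots\to p_{-1}\to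 p_0\to p_1\to\cdots$ all of whose vertices are decorated, rooted at $p_0$. - $\hat{\mathcal{R}}$ has two disjoint bi-infinite spines $(p_i)_{i\in\mathbb{Z}}$ and $(q_i)_{i\in\mathbb{Z}}$, and a reticulation $\rho_0$ whose two parents are $p_0$ and $q_0$ and whose only child is a leaf $\ell_0$; every $p_i,q_i$ with $i\ne0$ is decorated, while $p_0,q_0$ have $\rho_0$ as their only reticulation child. It is rooted at $\rho_0$. - $\hat{\mathsf{N}}^{\mathrm{lf}}$ is the same directed graph as $\hat{\mathcal{R}}$, rooted at $\ell_0$ instead. *)

(* Defs.v *)
From mathcomp Require Import all_boot all_order all_algebra finmap.
From mathcomp Require Import boolp classical_sets cardinality reals.
From mathcomp Require Import topology normedtype sequences.
Set Implicit Arguments.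
Unset Strict Implicit.
Unset Printing Implicit Defensive.
Import Order.TTheory GRing.Theory Num.Theory.
Import numFieldNormedType.Exports.

Local Open Scope ring_scope.

Inductive vmark := MRoot | MTree | MRetic | MLeaf.

Record mdigraph := MDigraph {
  vertex :> Type;
  edge : vertex -> vertex -> Prop;
  mark : vertex -> vmark }.

Record rmdigraph := RMDigraph {
  rgraph :> mdigraph;
  rroot : rgraph }.

Definition rmiso (G H : rmdigraph) : Prop :=
  exists f : G -> H,
    [/\ bijective f,
        forall x y, edge x y <-> edge (f x) (f y),
        forall x, mark (f x) = mark x
      & f (rroot G) = rroot H].

Fixpoint dist_le (N : mdigraph) (r : nat) (u v : N) : Prop :=
  match r with
  | 0 => u = v
  | r'.+1 => dist_le r' u v \/
             exists2 w, dist_le r' u w & (edge w v \/ edge v w)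
  end.

Lemma dist_le_refl (N : mdigraph) (r : nat) (v : N) : dist_le r v v.
Proof. by elim: r => [//|r IHr] /=; left. Qed.

(* The neighbourhood U_r(N, v), rooted at v. *)
Definition ball_graph (r : nat) (N : mdigraph) (v : N) : rmdigraph :=
  RMDigraph (rgraph := @MDigraph {u : N | dist_le r v u}
                         (fun x y => edge (sval x) (sval y))
                         (fun x => mark (sval x)))
            (exist _ v (dist_le_refl r v)).

(* Every isomorphism class of finite digraphs with n labelled leaves has a
   representative on some 'I_m.  A relation suffices for the edges: the
   tree-child condition rules out parallel edges. *)
Record lnet (n : nat) := LNet {
  order : nat;
  arc : rel 'I_order;
  label : 'I_n -> 'I_order }.

Section Networks.
Variables (n : nat) (N : lnet n).
Implicit Types u v : 'I_(order N).

Definition indeg v := #|[pred u | arc u v]|.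
Definition outdeg v := #|[pred w | arc v w]|.
Definition is_root v := (indeg v == 0%N) && (outdeg v == 1%N).
Definition is_tree v := (indeg v == 1%N) && (outdeg v == 2).
Definition is_retic v := (indeg v == 2) && (outdeg v == 1%N).
Definition is_leaf v := v \in codom (@label n N).

Definition simplex_tree_child : Prop :=
  (exists o, [/\ is_root o,
       forall v, connect (@arc n N) o v
     & forall v, v != o -> ~~ is_leaf v -> is_tree v || is_retic v]) /\
  [/\ forall u v, arc u v -> ~~ connect (@arc n N) v u,
      injective (@label n N),
      forall v, is_leaf v -> (indeg v == 1%N) && (outdeg v == 0%N),
      forall v, ~~ is_leaf v -> exists w, arc v w && (is_tree w || is_leaf w)
    & forall v w, is_retic v -> arc v w -> is_leaf w].

(* The fallback MRoot is reached only by the root when N is a network. *)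
Definition net_mark v : vmark :=
  if is_leaf v then MLeaf
  else if is_tree v then MTree
  else if is_retic v then MRetic
  else MRoot.

Definition net_graph : mdigraph :=
  @MDigraph 'I_(order N) (fun u v => arc u v) net_mark.

(* When no vertex satisfies P this is 0, as x / 0 = 0. *)
Definition local_freq (R : realType) (P : pred 'I_(order N)) (r : nat)
    (G : rmdigraph) : R :=
  #|[pred u | P u && `[< rmiso (@ball_graph r net_graph u) G >]]|%:R
    / #|[pred u | P u]|%:R.

End Networks.

Definition net_iso (n : nat) (N M : lnet n) : Prop :=
  exists f : 'I_(order N) -> 'I_(order M),
    [/\ bijective f,
        forall u v, arc u v = arc (f u) (f v)
      & forall i, f (label N i) = label M i].

Definition iso_class (n : nat) (N : lnet n) : set (lnet n) := net_iso N.

Section Uniform.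
Variable R : realType.
Local Open Scope classical_set_scope.

(* Uniform law on the (finite) set of isomorphism classes of networks; it is
   meant for events A that are invariant under net_iso.  [fset_set] of a finite
   set is that set; the set of classes is finite since a network with k
   reticulations has k <= n and 2n + 2k vertices. *)
Definition unif_prob (n : nat) (A : set (lnet n)) : R :=
  #|` fset_set (@iso_class n @` (@simplex_tree_child n `&` A))|%:R
    / #|` fset_set (@iso_class n @` @simplex_tree_child n)|%:R.

Definition cvg_in_prob (X : forall n, lnet n -> R) (c : R) : Prop :=
  forall e : R, 0 < e ->
    (fun n => unif_prob [set N : lnet n | e < `|X n N - c|]) @ \oo --> (0 : R).

End Uniform.

(* The recursive decoration, starting from base spines indexed by B on which
   exactly the positions satisfying D are decorated.  [dvertex] is the type of
   the decorated tree vertices.  Decorating x creates rho(x) = [ReticV x],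
   l(x) = [LeafV x] and the spine [New x], with w(x) at its position 0, so that
   the decorated vertices of [New x] are those at the positions i != 0. *)
Inductive dvertex (B : Type) (D : pred int) : Type :=
  | OnBase (b : B) (i : int) of D i
  | OnNew (x : dvertex B D) (i : int) of i != 0.

Inductive spine (B : Type) (D : pred int) : Type :=
  | Base of B
  | New of dvertex B D.
Arguments Base {B D}.
Arguments New {B D}.

Inductive svertex (B : Type) (D : pred int) : Type :=
  | SpineV of spine B D & int
  | ReticV of dvertex B D
  | LeafV of dvertex B D.
Arguments SpineV {B D}.
Arguments ReticV {B D}.
Arguments LeafV {B D}.

Definition tree_of (B : Type) (D : pred int) (x : dvertex B D) : svertex B D :=
  match x with
  | OnBase b i _ => SpineV (Base b) i
  | OnNew y i _ => SpineV (New y) i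
  end.

Inductive sedge (B : Type) (D : pred int) : svertex B D -> svertex B D -> Prop :=
  | SpineE s i : sedge (SpineV s i) (SpineV s (i + 1))
  | ReticE x : sedge (tree_of x) (ReticV x)
  | JoinE x : sedge (SpineV (New x) 0) (ReticV x)
  | LeafE x : sedge (ReticV x) (LeafV x).

Definition smark (B : Type) (D : pred int) (v : svertex B D) : vmark :=
  match v with
  | SpineV _ _ => MTree
  | ReticV _ => MRetic
  | LeafV _ => MLeaf
  end.

Definition Lhat : mdigraph := MDigraph (@sedge unit xpredT) (@smark unit xpredT).
Definition Lhat_p0 : Lhat := SpineV (Base tt) 0.

(* The spines p and q are [Base false] and [Base true]. *)
Definition nz : pred int := fun i => i != 0.
Inductive rvertex : Type :=
  | Old of svertex bool nz
  | Rho0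
  | Ell0.

Inductive redge : rvertex -> rvertex -> Prop :=
  | OldE u v : sedge u v -> redge (Old u) (Old v)
  | Rho0E b : redge (Old (SpineV (Base b) 0)) Rho0
  | Ell0E : redge Rho0 Ell0.

Definition rmark (v : rvertex) : vmark :=
  match v with
  | Old u => smark u
  | Rho0 => MRetic
  | Ell0 => MLeaf
  end.

Definition Rhat : mdigraph := MDigraph redge rmark.
Definition Rhat_rho0 : Rhat := Rho0.

Definition Nlf : mdigraph := Rhat.
Definition Nlf_ell0 : Nlf := Ell0.

(* The limits are deterministic: P(U_r(N, v) =~ G) is 0 or 1. *)
Definition det_prob (R : realType) (r : nat) (N : mdigraph) (v : N)
    (G : rmdigraph) : R := (`[< rmiso (ball_graph r v) G >])%:R.

(* Main.v *)
(** Call a leaf free when its parent is not a reticulation, and let [J] be the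
    number of free leaves.  The root, the free leaves and the [J - 1] tree
    vertices without a reticulation child are the only defects of a network.
    A vertex far away from the defects and from the short (undirected) cycles
    has the neighbourhood of the limit: the limit graph maps to the network by
    a local isomorphism, and this map is injective on a ball as soon as its
    image contains no short cycle.  So it suffices that [J] and the number of
    short cycles are [o(n)] in probability.  Both follow by switching, that is
    by injections between marked networks (networks are rigid, so that counting
    isomorphism classes is harmless).
    - Put a free leaf below a new reticulation, one parent of which is taken
      among the [J - 1] tree vertices without reticulation child: there are
      [J (J - 1)] choices, and the new reticulation with one of its parents
      marked, [O(n)] choices, remembers everything.  Hence [P(J > n / d)] is
      [O(1 / n)].
    - Exchange the reticulation children of two tree vertices [p1] and [p2].
      If the reticulation below [p1] lies on a short cycle, then [p1] and [p2]
      are close to each other afterwards.  There are about [2 n] choices of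
      [p2] for each such [p1], and [O(n)] pairs of close vertices. *)

Require Import Defs.
From mathcomp Require Import all_boot all_order all_algebra.
From mathcomp Require Import boolp classical_sets cardinality reals.
From mathcomp Require Import perm zify finmap topology normedtype sequences.
From Stdlib Require List.
Import Order.TTheory GRing.Theory Num.Theory numFieldNormedType.Exports.
Import Defs.

Set Implicit Arguments.
Unset Strict Implicit.
Unset Printing Implicit Defensive.

(** * Structure of simplex tree-child networks *)

Lemma card2_predE (T : finType) (P : pred T) x y z :
  #|P| <= 2 -> x != y -> P x -> P y -> P z = (z == x) || (z == y).
Proof.
move=> P2 xy Px Py; apply/idP/orP => [Pz|[/eqP->|/eqP->] //].
apply/orP; apply: contraT; rewrite negb_or => /andP[zx zy].
have : #|(z |: [set x; y])%SET| <= #|P|.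
  apply: subset_leq_card; apply/fintype.subsetP => w.
  by rewrite !inE => /or3P[] /eqP->.
by rewrite cardsU1 cards2 !inE negb_or zx zy xy leqNgt ltnS P2.
Qed.

Lemma card2_other (T : finType) (P : pred T) x :
  1 < #|P| -> exists2 y, P y & y != x.
Proof.
case/card_gt1P=> y [z [Py Pz yz]]; have [yx|] := eqVneq y x; last by exists y.
by exists z; rewrite // -yx eq_sym.
Qed.

Section Structure.
Variables (n : nat) (N : lnet n).
Notation V := 'I_(order N).
Implicit Types u v w : V.

Definition adj u v := arc u v || arc v u.

Lemma adj_sym : symmetric adj.
Proof. by move=> u v; rewrite /adj orbC. Qed.

(* A rank function gives acyclicity, and reachability from the root as well,
   since every other vertex has a parent. *)
Lemma stc_intro (o : V) (rk : V -> nat) :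
  is_root o -> {homo rk : u v / arc u v >-> u < v} ->
  (forall v, v != o -> ~~ is_leaf v -> is_tree v || is_retic v) ->
  injective (@label n N) ->
  (forall v, is_leaf v -> (indeg v == 1) && (outdeg v == 0)) ->
  (forall v, ~~ is_leaf v -> exists w, arc v w && (is_tree w || is_leaf w)) ->
  (forall v w, is_retic v -> arc v w -> is_leaf w) ->
  simplex_tree_child N.
Proof.
move=> ro rkP typ labi leafP tc oc; split; last first.
  split=> // u v uv; apply/negP => /connectP [p pth eu].
  have : rk v <= rk (last v p).
    elim: p v pth {uv eu} => //= w p IHp v /andP[vw pth].
    by apply: leq_trans (IHp w pth); apply/ltnW/rkP.
  by rewrite -eu leqNgt rkP.
exists o; split=> // v.
have [k] := ubnP (rk v); elim: k v => // k IHk v; rewrite ltnS => lek.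
have [->|vo] := eqVneq v o; first exact: connect0.
have : 0 < indeg v.
  have [/leafP /andP[/eqP-> //]|nl] := boolP (is_leaf v).
  by have /orP[] := typ _ vo nl; case/andP => /eqP->.
case/card_gt0P => u; rewrite inE => uv.
apply: connect_trans (connect1 uv); apply: IHk.
exact: leq_trans (rkP _ _ uv) lek.
Qed.

Hypothesis stc : simplex_tree_child N.

Lemma acyc u v : arc u v -> ~~ connect (@arc n N) v u.
Proof. by case: stc => _ [A L _ _ _]; auto. Qed.

Lemma label_inj : injective (@label n N).
Proof. by case: stc => _ [A L _ _ _]; auto. Qed.

Lemma leaf_deg v : is_leaf v -> (indeg v == 1) && (outdeg v == 0).
Proof. by case: stc => _ [_ _ H _ _]; apply: H. Qed.

Lemma tree_child v :
  ~~ is_leaf v -> exists w, arc v w && (is_tree w || is_leaf w).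
Proof. by case: stc => _ [_ _ _ H _]; apply: H. Qed.

Lemma retic_child v w : is_retic v -> arc v w -> is_leaf w.
Proof. by case: stc => _ [_ _ _ _ H]; apply: H. Qed.

(** The number of ancestors of [v], itself included. By acyclicity it strictly increases along arcs,
    and so serves as a topological order for inductions and extremal choices. *)
Definition rank v := #|[pred u | connect (@arc n N) u v]|.

Lemma rank_lt u v : arc u v -> rank u < rank v.
Proof.
move=> uv; apply: proper_card; apply/properP; split.
  apply/fintype.subsetP => w; rewrite !inE => wu.
  exact: connect_trans wu (connect1 uv).
by exists v; rewrite inE ?connect0 // acyc.
Qed.

Lemma rank_gt0 v : 0 < rank v.
Proof. by apply/card_gt0P; exists v; rewrite inE connect0. Qed.

Lemma rank_le v : rank v <= order N.
Proof. by rewrite -[leqRHS]card_ord max_card. Qed.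

Lemma arc_irr v : arc v v = false.
Proof. by apply/negP => /rank_lt; rewrite ltnn. Qed.

Lemma arc_asym u v : arc u v -> arc v u = false.
Proof.
by move=> /rank_lt uv; apply/negP => /rank_lt vu; have := ltn_trans uv vu;
  rewrite ltnn.
Qed.

Lemma leaf_out v w : is_leaf v -> arc v w = false.
Proof.
move=> /leaf_deg /andP[_ /eqP/card0_eq out0].
by have := out0 w; rewrite inE.
Qed.

(** All four types and both degrees are indices, so that one case analysis on [vtypeP] evaluates
    them simultaneously. *)
Variant vertex_spec : bool -> bool -> bool -> bool -> nat -> nat -> Prop :=
  | RootSpec : vertex_spec true false false false 0 1
  | TreeSpec : vertex_spec false true false false 1 2
  | ReticSpec : vertex_spec false false true false 2 1
  | LeafSpec : vertex_spec false false false true 1 0.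

Lemma vtypeP v :
  vertex_spec (is_root v) (is_tree v) (is_retic v) (is_leaf v)
              (indeg v) (outdeg v).
Proof.
have [lf|nl] := boolP (is_leaf v).
  have /andP[/eqP i /eqP o] := leaf_deg lf.
  by rewrite /is_root /is_tree /is_retic i o; constructor.
case: stc => [[o [ro _ typ]] _].
have : is_root v || is_tree v || is_retic v.
  have [->|vo] := eqVneq v o; first by rewrite ro.
  by rewrite -orbA typ // orbT.
rewrite /is_root /is_tree /is_retic.
by case: (indeg v) => [|[|[|]]] //; case: (outdeg v) => [|[|[|]]] //;
  constructor.
Qed.

Lemma in_uniq v u w : indeg v <= 1 -> arc u v -> arc w v -> u = w.
Proof. by move=> /card_le1_eqP eqP uv wv; apply: eqP; rewrite inE. Qed.

Lemma out_uniq v u w : outdeg v <= 1 -> arc v u -> arc v w -> u = w.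
Proof. by move=> /card_le1_eqP eqP uv wv; apply: eqP; rewrite inE. Qed.

Lemma root_unique u v : is_root u -> is_root v -> u = v.
Proof.
case: stc => [[o [ro con _]] _].
suff rooto w : is_root w -> w = o by move=> /rooto -> /rooto ->.
move=> /andP[/eqP/card0_eq in0 _].
have /connectP[p] := con w; case/lastP: p => [//|p x].
rewrite rcons_path last_rcons => /andP[_ xw] ew.
by have := in0 (last o p); rewrite inE ew xw.
Qed.

Lemma root_exists : exists o : V, is_root o.
Proof. by case: stc => [[o [ro _ _]] _]; exists o. Qed.

Lemma leaf_in v : is_leaf v -> exists u, arc u v.
Proof.
move=> /leaf_deg/andP[/eqP iv _].
have /card_gt0P[u] : 0 < indeg v by rewrite iv.
by rewrite inE; exists u.
Qed.

(** A root or a reticulation has a single child, which the tree-child condition forces to be a tree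
    vertex or a leaf. *)
Lemma retic_parent u v : is_retic v -> arc u v -> is_tree u.
Proof.
move=> rv uv; case: (vtypeP u) (@tree_child u) (@retic_child u) (@leaf_out u)
    (@out_uniq u) => // [tc _ _ ou|_ rc _ _|_ _ lo _].
- have [//|w /andP[uw]] := tc; rewrite (ou w v) //.
  by case: (vtypeP v) rv.
- by have := rc v isT uv; case: (vtypeP v) rv.
- by rewrite lo in uv.
Qed.

Lemma retic_has_child v : is_retic v -> exists w, arc v w.
Proof.
move=> rv; have /card_gt0P[u] : 0 < outdeg v by case: (vtypeP v) rv.
by rewrite inE; exists u.
Qed.

Lemma tree_has_parent v : is_tree v -> exists w, arc w v.
Proof.
move=> rv; have /card_gt0P[u] : 0 < indeg v by case: (vtypeP v) rv.
by rewrite inE; exists u.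
Qed.

Lemma sum_bool_card (P : pred V) : \sum_v (P v : nat) = #|P|.
Proof.
rewrite -sum1_card [RHS]big_mkcond; apply: eq_bigr => v _.
by rewrite -[v \in P]/(P v); case: (P v).
Qed.

Lemma sum_types :
  (\sum_(v : V) (is_root v : nat) = #|@is_root n N|) *
  (\sum_(v : V) (is_tree v : nat) = #|@is_tree n N|) *
  (\sum_(v : V) (is_retic v : nat) = #|@is_retic n N|) *
  (\sum_(v : V) (is_leaf v : nat) = #|@is_leaf n N|).
Proof. by do !split; apply: sum_bool_card. Qed.

(** Double counting of the arcs from [Q] to [P], by heads and by tails. It underlies the degree
    counts below. *)
Lemma sum_arc (P Q : pred V) :
  \sum_(v | P v) #|[pred u | Q u && arc u v]| =
  \sum_(u | Q u) #|[pred v | P v && arc u v]|.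
Proof.
transitivity (\sum_(v | P v) \sum_(u | Q u) (arc u v : nat)).
  apply: eq_bigr => v _; rewrite -sum1_card big_mkcond [RHS]big_mkcond /=.
  by apply: eq_bigr => u _; rewrite inE; case: (Q u); case: (arc u v).
rewrite exchange_big; apply: eq_bigr => u _.
rewrite -sum1_card big_mkcond [RHS]big_mkcond /=.
by apply: eq_bigr => v _; rewrite inE; case: (P v); case: (arc u v).
Qed.

(** Deleting the reticulations and the leaves below them leaves a tree; the names refer to the
    number of children, one or two, that a tree vertex keeps there. *)
Definition unary u := is_tree u && [exists v, is_retic v && arc u v].
Definition binary u := is_tree u && ~~ [exists v, is_retic v && arc u v].
Definition retic_leaf v := is_leaf v && [exists u, is_retic u && arc u v].
Definition free_leaf v := is_leaf v && ~~ [exists u, is_retic u && arc u v].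

Lemma retic_child_uniq u v w :
  is_retic v -> is_retic w -> arc u v -> arc u w -> v = w.
Proof.
move=> rv rw uv uw; have tu := retic_parent rv uv.
have [|x /andP[ux tx]] := @tree_child u; first by case: (vtypeP u) tu.
have nx : ~~ is_retic x by case: (vtypeP x) tx.
apply/eqP; apply: contraT => vw.
have out2 : outdeg u <= 2 by case: (vtypeP u) tu.
have := @card2_predE _ [pred z | arc u z] v w x out2 vw uv uw.
by rewrite /= ux => /esym/orP[] /eqP ex; rewrite ex ?rv ?rw in nx.
Qed.

Lemma card_retic_children u : #|[pred v | is_retic v && arc u v]| = unary u.
Proof.
rewrite /unary; have [/existsP[v /andP[rv uv]]|] := boolP [exists v, is_retic v && arc u v].
  rewrite (retic_parent rv uv) /=; rewrite -(card1 v); apply: eq_card => w; rewrite !inE.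
  apply/andP/eqP => [[rw uw]|-> //]; exact: (retic_child_uniq rw rv uw uv).
move=> /existsPn none; rewrite andbF; apply: eq_card0 => v.
by rewrite inE (negbTE (none v)).
Qed.

(** Every reticulation has two parents, and a parent is never shared by two reticulations. *)
Lemma card_unary : #|unary| = #|@is_retic n N| * 2.
Proof.
have := sum_arc (@is_retic n N) predT.
rewrite (eq_bigr (fun=> 2)) => [|v rv]; last first.
  by rewrite -[LHS]/(indeg v); case: (vtypeP v) rv.
rewrite sum_nat_cond_const cardsE => ->; rewrite -sum1_card big_mkcond /=.
by apply: eq_bigr => u _; rewrite card_retic_children -[u \in unary]/(unary u); case: (unary u).
Qed.

Lemma card_retic_leaf : #|retic_leaf| = #|@is_retic n N|.
Proof.
have := sum_arc (@is_leaf n N) (@is_retic n N).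
rewrite [RHS](eq_bigr (fun=> 1)) => [|u ru]; last first.
  have /eqP ou : outdeg u == 1 by case: (vtypeP u) ru.
  rewrite -ou; apply: eq_card => v; rewrite !inE.
  by apply/andP/idP => [[]|uv] //; rewrite (retic_child ru uv).
rewrite sum1_card => <-; rewrite -sum1_card big_mkcond [RHS]big_mkcond /=.
apply: eq_bigr => v _; rewrite unfold_in /retic_leaf.
have [lv|//] := boolP (is_leaf v).
have /andP[/eqP iv _] := leaf_deg lv.
have [/existsP[u /andP[ru uv]]|/existsPn none] := boolP [exists u, is_retic u && arc u v].
  rewrite -(card1 u); apply: eq_card => w; rewrite !inE.
  by apply/eqP/andP => [->|[rw wv]] //; apply: in_uniq wv uv; rewrite iv.
by rewrite /= eq_card0 // => u; rewrite inE (negbTE (none u)).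
Qed.

Lemma card_leaf : #|@is_leaf n N| = n.
Proof. by rewrite -[RHS]card_ord -(card_codom label_inj); apply: eq_card. Qed.

Lemma card_free_leaf : #|free_leaf| + #|@is_retic n N| = n.
Proof.
rewrite -card_retic_leaf -[RHS]card_leaf.
rewrite -(cardID [pred v | [exists u, is_retic u && arc u v]] (@is_leaf n N)).
rewrite addnC; congr (_ + _); apply: eq_card => v; rewrite !inE unfold_in //.
by rewrite /free_leaf andbC.
Qed.

Lemma card_root : #|@is_root n N| = 1.
Proof.
have [o ro] := root_exists; rewrite -(card1 o); apply: eq_card => v.
rewrite !inE unfold_in; apply/idP/eqP => [rv|-> //]; exact: root_unique.
Qed.

(** Equality of the sum of the indegrees and the sum of the outdegrees. *)
Lemma card_tree : (#|@is_tree n N| + 1 = n + #|@is_retic n N|).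
Proof.
have := sum_arc predT predT.
rewrite (eq_bigr (@indeg n N)) => [|v _]; last by apply: eq_card.
rewrite [RHS](eq_bigr (@outdeg n N)) => [|v _]; last by apply: eq_card.
rewrite (eq_bigr (fun v => is_tree v + is_retic v * 2 + is_leaf v)); last first.
  by move=> v _; case: (vtypeP v).
rewrite [RHS](eq_bigr (fun v => is_root v + is_tree v * 2 + is_retic v)); last first.
  by move=> v _; case: (vtypeP v).
rewrite !big_split /= -!big_distrl /= !sum_types card_root card_leaf; lia.
Qed.

(** With $k$ reticulations there are $n + k - 1$ tree vertices, $2k$ of which are unary, and $n - k$
    free leaves. *)
Lemma card_binary : #|binary| + 1 = #|free_leaf|.
Proof.
have : #|unary| + #|binary| = #|@is_tree n N|.
  rewrite -(cardID [pred u | [exists v, is_retic v && arc u v]] (@is_tree n N)).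
  congr (_ + _); apply: eq_card => v; rewrite !inE !unfold_in //.
  by rewrite /binary andbC.
have := card_unary; have := card_tree; have := card_free_leaf; lia.
Qed.

Lemma card_vertex : order N <= 4 * n.
Proof.
have : order N = \sum_(v : V) (is_root v + is_tree v + is_retic v + is_leaf v).
  rewrite -[LHS]card_ord -sum1_card; apply: eq_bigr => v _.
  by case: (vtypeP v).
rewrite !big_split /= !sum_types card_root card_leaf.
have := card_tree; have := card_free_leaf; lia.
Qed.

Lemma card_adj v : #|[pred u | adj v u]| <= 3.
Proof.
rewrite (@leq_trans (indeg v + outdeg v)) //; last by case: (vtypeP v).
rewrite addnC /indeg /outdeg -cardUI; apply: leq_trans (leq_addr _ _).
by apply: subset_leq_card; apply/fintype.subsetP => u; rewrite !inE.
Qed.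

Fixpoint ball r v : {set V} :=
  if r is r'.+1 then
    (ball r' v :|: \bigcup_(w in ball r' v) [set u | adj w u])%SET
  else [set v]%SET.

Lemma ballP r v u : reflect (@dist_le (net_graph N) r v u) (u \in ball r v).
Proof.
apply: (iffP idP); elim: r u => [|r IHr] u /=.
- by rewrite inE => /eqP->.
- rewrite inE => /orP[/IHr|/bigcupP[w /IHr wv]]; first by left.
  by rewrite inE => /orP wu; right; exists w.
- by move=> ->; rewrite inE.
- rewrite inE => -[/IHr->//|[w /IHr wv wu]]; apply/orP; right.
  by apply/bigcupP; exists w => //; rewrite inE; apply/orP; case: wu; auto.
Qed.

(** Degrees are at most 3, so one more step multiplies the size by at most 4. *)
Lemma card_ball r v : #|ball r v| <= 4 ^ r.
Proof.
elim: r => [|r IHr] /=; first by rewrite cards1.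
apply: leq_trans (leq_card_setU _ _).1 _.
have : #|\bigcup_(w in ball r v) [set u | adj w u]%SET| <= #|ball r v| * 3.
  rewrite -sum_nat_const.
  apply: (@leq_trans (\sum_(w in ball r v) #|[set u | adj w u]%SET|)).
    elim/big_rec2: _ => [|w x A _ le]; first by rewrite cards0.
    by apply: leq_trans (leq_card_setU _ _).1 _; rewrite leq_add2l.
  apply: leq_sum => w _; rewrite cardsE; exact: card_adj.
move=> le; apply: leq_trans (leq_add IHr (leq_trans le (leq_mul IHr (leqnn 3)))) _.
by rewrite expnS mulSn mulnC.
Qed.

Lemma ball_center r v : v \in ball r v.
Proof. by elim: r => [|r IHr] /=; rewrite inE ?IHr. Qed.

Lemma ball_step r u v w : u \in ball r v -> adj u w -> w \in ball r.+1 v.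
Proof.
by move=> uv uw; rewrite /= inE; apply/orP; right; apply/bigcupP; exists u;
  rewrite ?inE.
Qed.

Lemma ball_leq r s v : r <= s -> ball r v \subset ball s v.
Proof.
move=> /subnKC <-; elim: (s - r) => [|k IHk]; first by rewrite addn0.
by rewrite addnS; apply: fintype.subset_trans IHk _; apply: finset.subsetUl.
Qed.

Lemma ball_trans r s u v w :
  u \in ball r v -> w \in ball s u -> w \in ball (r + s) v.
Proof.
move=> uv; elim: s w => [|s IHs] w /=.
  by rewrite inE addn0 => /eqP->.
rewrite addnS inE => /orP[/IHs|/bigcupP[x /IHs xv]].
  by apply/fintype.subsetP/ball_leq.
by rewrite inE => xw; apply: ball_step xv xw.
Qed.

Lemma ball_sym r u v : (u \in ball r v) = (v \in ball r u).
Proof.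
suff imp x y : x \in ball r y -> y \in ball r x by apply/idP/idP; apply: imp.
elim: r x y => [|r IHr] x y; first by rewrite /= !inE eq_sym.
rewrite [X in X -> _]/= inE => /orP[/IHr|/bigcupP[z /IHr zy]].
  by apply/fintype.subsetP/ball_leq.
rewrite inE => zx; rewrite -add1n; apply: ball_trans zy.
by apply: ball_step (ball_center 0 x) _; rewrite adj_sym.
Qed.

Lemma card_near (Z : {set V}) r :
  #|[set v | [exists z in Z, z \in ball r v]]%SET| <= #|Z| * 4 ^ r.
Proof.
apply: (@leq_trans #|\bigcup_(z in Z) ball r z|).
  apply: subset_leq_card; apply/fintype.subsetP => v; rewrite inE.
  case/exists_inP => z zZ; rewrite ball_sym => vz; by apply/bigcupP; exists z.
rewrite -sum_nat_const.
apply: (@leq_trans (\sum_(z in Z) #|ball r z|)).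
  elim/big_rec2: _ => [|w x A _ le]; first by rewrite cards0.
  by apply: leq_trans (leq_card_setU _ _).1 _; rewrite leq_add2l.
by apply: leq_sum => z _; apply: card_ball.
Qed.

End Structure.

Lemma card_bij (S T : finType) (f : S -> T) (P : pred S) (Q : pred T) :
  bijective f -> (forall x, P x = Q (f x)) -> #|P| = #|Q|.
Proof.
move=> bf PQ; rewrite -(on_card_preimset (onW_bij _ bf)) cardsE.
by apply: eq_card => x; apply: PQ.
Qed.

(** * Rigidity and counting up to isomorphism *)

Section Isomorphisms.
Variable n : nat.
Implicit Types N M L : lnet n.
Notation V N := ('I_(order N)).

Definition iso_map N M (f : V N -> V M) :=
  [/\ bijective f, forall u v, arc u v = arc (f u) (f v)
    & forall i, f (label N i) = label M i].

Definition marked_iso N (u v : V N) M (u' v' : V M) :=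
  exists f : V N -> V M, [/\ iso_map f, f u = u' & f v = v'].

Lemma iso_map_inv N M (f : V N -> V M) :
  iso_map f -> exists2 g, iso_map g & cancel f g /\ cancel g f.
Proof.
case=> [[g fK gK] fa fl]; exists g => //; split; first by exists f.
  by move=> u v; rewrite fa !gK.
by move=> i; rewrite -fl fK.
Qed.

Lemma iso_map_comp N M L (f : V N -> V M) (g : V M -> V L) :
  iso_map f -> iso_map g -> iso_map (g \o f).
Proof.
case=> [bf fa fl] [bg ga gl]; split; first exact: bij_comp.
  by move=> u v; rewrite fa ga.
by move=> i /=; rewrite fl gl.
Qed.

Lemma marked_iso_sym N (u v : V N) M (u' v' : V M) :
  marked_iso u v u' v' -> marked_iso u' v' u v.
Proof.
case=> f [/iso_map_inv[g ig [fK gK]] <- <-]; exists g.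
by split; rewrite ?fK.
Qed.

Lemma marked_iso_trans N (u v : V N) M (u' v' : V M) L (u2 v2 : V L) :
  marked_iso u v u' v' -> marked_iso u' v' u2 v2 -> marked_iso u v u2 v2.
Proof.
case=> f [if_ <- <-] [g [ig <- <-]]; exists (g \o f).
by split=> //; apply: iso_map_comp.
Qed.

Lemma iso_map_deg N M (f : V N -> V M) v : iso_map f ->
  (indeg (f v) = indeg v) * (outdeg (f v) = outdeg v).
Proof.
case=> [bf fa _]; split.
  by apply/esym; apply: card_bij bf _ => u; rewrite /= fa.
by apply/esym; apply: card_bij bf _ => u; rewrite /= fa.
Qed.

Lemma iso_map_retic N M (f : V N -> V M) v :
  iso_map f -> is_retic (f v) = is_retic v.
Proof. by move=> if_; rewrite /is_retic !(iso_map_deg v if_). Qed.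

Lemma iso_map_ball N M (f : V N -> V M) r u v : iso_map f ->
  u \in ball r v -> f u \in ball r (f v).
Proof.
case=> [_ fa _]; elim: r u => [|r IHr] u /=; first by rewrite !inE => /eqP->.
rewrite inE => /orP[/IHr uv|/bigcupP[w /IHr wv]]; first by rewrite inE uv.
by rewrite inE => wu; apply: ball_step wv _; rewrite /adj -!fa.
Qed.

(* Upwards from the leaves: a non-leaf vertex is the unique parent of one of
   its children. *)
Lemma iso_map_uniq N M (f g : V N -> V M) :
  simplex_tree_child N -> iso_map f -> iso_map g -> f =1 g.
Proof.
move=> stc if_ ig v.
have [k] := ubnP (order N - rank v); elim: k v => // k IHk v; rewrite ltnS => lek.
have [/codomP[i ->]|nl] := boolP (is_leaf v).
  by case: if_ ig => _ _ -> [_ _ ->].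
have [w /andP[vw tw]] := tree_child stc nl.
have fgw : f w = g w.
  apply: IHk; apply: leq_trans lek; have := rank_lt stc vw; have := rank_le w.
  lia.
apply: (@in_uniq _ _ (f w)).
- rewrite (iso_map_deg w if_); case: (vtypeP stc w) tw => //.
- by case: if_ => _ <-.
- by rewrite fgw; case: ig => _ <-.
Qed.

End Isomorphisms.

(** * Counting marked networks through an injective surgery *)

Section DoubleCounting.
Variables (n : nat) (T : finType) (rep : T -> lnet n).
Hypothesis rep_stc : forall x, simplex_tree_child (rep x).
Hypothesis rep_onto :
  forall N, simplex_tree_child N -> exists x, net_iso N (rep x).
Hypothesis rep_inj : forall x y, net_iso (rep x) (rep y) -> x = y.
Notation V N := ('I_(order N)).

Variables (P : forall N : lnet n, V N -> V N -> bool) (L : nat).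
Variable surgery : forall N : lnet n, V N -> V N ->
  forall N' : lnet n, V N' -> V N' -> Prop.
Hypothesis surgeryP : forall N (u v : V N), simplex_tree_child N -> P u v ->
  exists N' (u' v' : V N'),
    [/\ simplex_tree_child N', v' \in ball L u' & surgery u v u' v'].
Hypothesis surgeryK : forall N1 (u1 v1 : V N1) N1' (u1' v1' : V N1')
                             N2 (u2 v2 : V N2) N2' (u2' v2' : V N2'),
  surgery u1 v1 u1' v1' -> surgery u2 v2 u2' v2' ->
  marked_iso u1' v1' u2' v2' -> marked_iso u1 v1 u2 v2.

(* By [surgeryK] the result of a surgery determines the marked network up to
   isomorphism, hence exactly, by rigidity. *)
Lemma surgery_count :
  \sum_x #|[pred p : V (rep x) * V (rep x) | P p.1 p.2]|
    <= #|T| * (4 * n * 4 ^ L).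
Proof.
(* Representatives with two marked vertices. The surgery is shown to induce an injection from those
   satisfying [P] to those whose marks are within distance [L]. *)
pose S := {x : T & (V (rep x) * V (rep x))%type}.
pose Q (a : S) := (tagged a).2 \in ball L (tagged a).1.
pose PS (a : S) := P (tagged a).1 (tagged a).2.
have sumS (A : forall x, pred (V (rep x) * V (rep x))) :
    \sum_x #|A x| = #|[pred a : S | A (tag a) (tagged a)]|.
  rewrite -sum1_card (eq_bigr (fun x => \sum_(p | A x p) 1)); last first.
    by move=> x _; rewrite -sum1_card.
  by rewrite sig_big_dep.
rewrite (sumS (fun x => [pred p | P p.1 p.2])).
apply: (@leq_trans #|[pred a | Q a]|); last first.
  rewrite -(sumS (fun x => [pred p | p.2 \in ball L p.1])) -sum_nat_const.
  apply: leq_sum => x _; rewrite -sum1_card.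
  rewrite -(pair_big_dep xpredT (fun u v => v \in ball L u) (fun _ _ => 1)) /=.
  apply: leq_trans (leq_mul (card_vertex (rep_stc x)) (leqnn _)).
  apply: (@leq_trans (\sum_(u < order (rep x)) 4 ^ L)); last first.
    by rewrite sum_nat_const card_ord.
  by apply: leq_sum => u _; rewrite sum1_card; apply: card_ball.
(* The result of a surgery is transported to the representative of its class. Where [P] fails the
   value is arbitrary. *)
have tgt (a : S) : exists b : S, PS a ->
    Q b /\ exists N' (u' v' : V N'), surgery (tagged a).1 (tagged a).2 u' v'
      /\ marked_iso u' v' (tagged b).1 (tagged b).2.
  have [Pa|nPa] := boolP (PS a); last by exists a.
  have [N' [u' [v' [st bl sg]]]] := surgeryP (rep_stc _) Pa.
  have [x [f isof]] := rep_onto st.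
  exists (existT _ x (f u', f v')) => _; split.
    exact: iso_map_ball.
  by exists N', u', v'; split=> //; exists f.
have [F FP] := choice tgt.
rewrite -(@card_in_imset _ _ F); last first.
  move=> a b; rewrite !inE => Pa Pb eF.
  have [_ [N1 [u1 [v1 [s1 i1]]]]] := FP a Pa.
  have [_ [N2 [u2 [v2 [s2 i2]]]]] := FP b Pb.
  rewrite eF in i1.
  have [f [isof]] :=
    surgeryK s1 s2 (marked_iso_trans i1 (marked_iso_sym i2)).
  case: a b {Pa Pb eF s1 i1 s2 i2} f isof => [x [u v]] [y [u' v']] /= f isof.
  have exy : x = y by apply: rep_inj; exists f.
  case: y / exy u' v' f isof => u' v' f isof.
  (* By rigidity the only automorphism is the identity, so the marks agree as well. *)
  have fid : f =1 id.
    apply: iso_map_uniq (rep_stc x) isof _; split=> //; by exists id.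
  by rewrite !fid => -> ->.
apply: subset_leq_card; apply/fintype.subsetP => b /imsetP[a].
by rewrite !inE => Pa ->; case: (FP a Pa).
Qed.

End DoubleCounting.

(** * Switching at two reticulations *)

Section Bad.
Variables (n : nat) (N : lnet n).
Notation V := 'I_(order N).

(* The reticulation below [p] lies on an undirected cycle through both its
   parents, of length at most [L + 2]. *)
Definition bad (L : nat) (p : V) := `[< exists rho s,
  [/\ is_retic rho, arc p rho, arc (last p s) rho, last p s != p &
      [/\ path (@adj n N) p s, rho \notin s & size s <= L]] >].

Lemma path_ball r p s x : path (@adj n N) p s -> size s <= r ->
  x \in p :: s -> x \in ball r p.
Proof.
move=> pth le; rewrite inE => /orP[/eqP->|]; first exact: ball_center.
move=> xs; suff : x \in ball (size s) p by apply/fintype.subsetP/ball_leq.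
elim/last_ind: s x pth {le} xs => // s y IHs x; rewrite rcons_path => /andP[pth ly].
rewrite size_rcons mem_rcons inE => /orP[/eqP->|/(IHs _ pth)]; last first.
  by apply/fintype.subsetP/ball_leq.
suff : last p s \in ball (size s) p by move/ball_step; apply.
case/lastP: s pth {ly} IHs => [|s z] pth IHs; first exact: ball_center.
by rewrite last_rcons; apply: IHs => //; rewrite mem_rcons mem_head.
Qed.

Lemma bad_unary L p : simplex_tree_child N -> bad L p -> unary p.
Proof.
move=> stc /asboolP[rho [s [rr pr _ _ _]]]; rewrite /unary.
rewrite (retic_parent stc rr pr) /=; apply/existsP; exists rho; exact/andP.
Qed.

End Bad.

Section Swap.
Variables (n : nat) (N : lnet n) (p1 p2 : 'I_(order N)).
Notation V := 'I_(order N).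

(* Exchanges the unique reticulation children of [p1] and [p2]. *)
Definition swap_net : lnet n :=
  LNet (fun u v => arc (if is_retic v then tperm p1 p2 u else u) v) (@label n N).

Hypothesis stc : simplex_tree_child N.
Hypotheses (un1 : unary p1) (un2 : unary p2).

Let N' := swap_net.

Lemma swap_indeg (v : V) : @indeg n N' v = indeg v.
Proof.
rewrite /indeg /=; case: (boolP (is_retic v)) => rv; last by [].
by apply: (card_bij (f := tperm p1 p2)) => //; apply: injF_bij; apply: perm_inj.
Qed.

(** Arcs to vertices that are not reticulations are untouched, and [p1] and [p2] keep exactly one
    reticulation child each. *)
Lemma swap_outdeg (u : V) : @outdeg n N' u = outdeg u.
Proof.
have inR v : (v \in @is_retic n N) = is_retic v by [].
have unt : unary (tperm p1 p2 u) = unary u by case: tpermP => [->|->|//]; rewrite un1 un2.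
rewrite /outdeg -(cardID (@is_retic n N)) -[RHS](cardID (@is_retic n N)).
congr (_ + _); last first.
  by apply: eq_card => v; rewrite !inE /= inR; case: is_retic.
transitivity (unary (tperm p1 p2 u) : nat).
  rewrite -card_retic_children //; apply: eq_card => v; rewrite !inE /= inR andbC.
  by case: is_retic; rewrite ?andbF.
by rewrite unt -card_retic_children //; apply: eq_card => v; rewrite !inE /= inR andbC.
Qed.

Lemma swap_type (v : V) :
  [/\ @is_root n N' v = is_root v, @is_tree n N' v = is_tree v,
      @is_retic n N' v = is_retic v & @is_leaf n N' v = is_leaf v].
Proof.
by split=> //; rewrite /is_root /is_tree /is_retic swap_indeg swap_outdeg.
Qed.

Lemma unary_tree (p : V) : unary p -> is_tree p. Proof. by case/andP. Qed.

Lemma swap_parent (u v : V) : is_retic v -> @arc n N' u v -> is_tree u.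
Proof.
move=> rv /=; rewrite rv => /(retic_parent stc rv).
by case: tpermP => [->|->|//] _; apply: unary_tree.
Qed.

Lemma swap_stc : simplex_tree_child N'.
Proof.
have [o ro] := root_exists stc.
pose M := (order N).+1.
(* The exchanged arcs need a rank that does not depend on their tails: reticulations, and then the
   leaves below them, are placed after everything else. *)
pose rk (v : V) := if is_retic v then M else
             if retic_leaf v then M.+1 else rank v.
have rkM (v : V) : rank v < M by rewrite ltnS rank_le.
apply: (@stc_intro _ N' o rk).
- by case: (swap_type o) => ->.
- move=> u v; rewrite /rk; have [rv uv|nrv] := boolP (@is_retic n N v).
    have tu := swap_parent rv uv.
    have -> : @is_retic n N u = false by case: (vtypeP stc u) tu.
    have -> : @retic_leaf n N u = false.
      by rewrite /retic_leaf; case: (vtypeP stc u) tu.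
    exact: rkM.
  rewrite /= (negbTE nrv) => uv.
  have [ru|nru] := boolP (@is_retic n N u).
    suff -> : @retic_leaf n N v by [].
    rewrite /retic_leaf (retic_child stc ru uv); apply/existsP; exists u.
    by rewrite ru.
  have -> : @retic_leaf n N u = false.
    by rewrite /retic_leaf; apply/andP => -[lu _]; rewrite (leaf_out stc _ lu) in uv.
  case: ifP => _; first by apply: ltnW; rewrite ltnS rkM.
  exact: rank_lt.
- move=> v vo; case: (swap_type v) => _ -> -> ->.
  have : @is_root n N v -> v = o by move=> rv; apply: root_unique rv ro.
  case: (vtypeP stc v) => // /(_ isT) ev; by rewrite ev eqxx in vo.
- exact: (label_inj stc).
- move=> v; case: (swap_type v) => _ _ _ ->.
  by rewrite swap_indeg swap_outdeg; apply: leaf_deg.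
- move=> v; case: (swap_type v) => _ _ _ -> /(tree_child stc)[w /andP[vw tw]].
  exists w; case: (swap_type w) => _ -> _ ->; rewrite tw andbT /=.
  by case: (vtypeP stc w) tw vw.
- move=> v w; case: (swap_type v) (swap_type w) => _ _ -> _ [_ _ _ ->] rv vw.
  have [rw|nrw] := boolP (@is_retic n N w).
    by have := swap_parent rw vw; case: (vtypeP stc v) rv.
  by move: vw; rewrite /= (negbTE nrw); apply: retic_child.
Qed.

(** The path joining the two parents of [rho] avoids [rho], and it avoids [p2], which is far from
    [p1]; hence it survives the exchange. It leads from [p1] to the other parent of [rho], and two
    more steps through [rho] reach [p2]. *)
Lemma swap_near L : bad L p1 -> p2 \notin ball L p1 ->
  p2 \in @ball n N' L.+2 p1.
Proof.
move=> /asboolP[rho [s [rr pr qr qp [pth rs les]]]] far.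
have inb x : x \in p1 :: s -> x \in ball L p1 by apply: path_ball.
have np2 x : x \in p1 :: s -> x != p2.
  by move=> /inb xb; apply: contraNneq far => <-.
have nrho x : x \in p1 :: s -> x != rho.
  rewrite inE => /orP[/eqP->|xs]; last by apply: contraNneq rs => <-.
  by apply: contraTneq pr => ->; rewrite arc_irr.
have arcS x y : x != p2 -> y != rho -> arc x y -> @arc n N' x y.
  move=> xp2 yr xy /=; case: ifP => // ry; rewrite tpermD // eq_sym //.
  apply: contraNneq yr => ex; rewrite ex in xy.
  by rewrite (retic_child_uniq stc ry rr xy pr).
have pth' : path (@adj n N') p1 s.
  apply/(pathP p1) => i lti; have := pathP p1 pth i lti.
  have m1 : nth p1 (p1 :: s) i \in p1 :: s by rewrite mem_nth //= ltnS ltnW.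
  have m2 : nth p1 s i \in p1 :: s by rewrite inE mem_nth ?orbT.
  by case/orP => xy; apply/orP; [left|right]; apply: arcS; auto.
have lastin : last p1 s \in p1 :: s by rewrite mem_last.
have q1 : last p1 s \in @ball n N' L p1 by apply: path_ball pth' les _.
have q2 : @adj n N' (last p1 s) rho.
  apply/orP; left; rewrite /= rr tpermD // eq_sym //; exact: np2.
have q3 : @adj n N' rho p2 by apply/orP; right; rewrite /= rr tpermR.
exact: ball_step (ball_step q1 q2) q3.
Qed.

(** For each bad [p1], all unary vertices outside a ball of at most [4 ^ L] vertices may serve as
    [p2]. *)
Lemma card_swap_pairs L :
  #|@bad n N L| * (#|@is_retic n N| * 2 - 4 ^ L) <=
  #|[pred p : V * V | [&& bad L p.1, unary p.2 & p.2 \notin ball L p.1]]|.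
Proof.
rewrite -(sum_nat_const (@bad n N L)).
apply: (@leq_trans (\sum_(u in @bad n N L)
   #|[pred v | unary v & v \notin ball L u]|)).
  apply: leq_sum => u _; rewrite -card_unary // leq_subLR.
  rewrite -(cardID (mem (ball L u)) (@unary n N)); apply: leq_add.
    apply: leq_trans (card_ball stc L u); apply: subset_leq_card.
    by apply/fintype.subsetP => v; rewrite !inE => /andP[].
  by apply: subset_leq_card; apply/fintype.subsetP => v; rewrite !inE andbC.
rewrite -[leqRHS]sum1_card.
rewrite -(pair_big_dep (@bad n N L) (fun u v => unary v && (v \notin ball L u)) (fun _ _ => 1)) /=.
by rewrite leq_eqVlt; apply/orP; left; apply/eqP; apply: eq_bigr => u _; rewrite sum1_card.
Qed.

End Swap.

(** Stated up to marked isomorphism, because networks with different vertex types have to be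
    compared. *)
Definition swap_surgery n (N : lnet n) (u v : 'I_(order N)) (N' : lnet n)
    (u' v' : 'I_(order N')) :=
  [/\ simplex_tree_child N, unary u, unary v &
      @marked_iso n (swap_net u v) u v N' u' v'].

(** The exchange is an involution determined by the two marks, and an isomorphism respecting the
    marks conjugates one transposition into the other. The same map is therefore an isomorphism
    before the exchange. *)
Lemma swap_surgeryK n (N1 : lnet n) (u1 v1 : 'I_(order N1)) N1'
    (u1' v1' : 'I_(order N1')) (N2 : lnet n) (u2 v2 : 'I_(order N2)) N2'
    (u2' v2' : 'I_(order N2')) :
  swap_surgery u1 v1 u1' v1' -> swap_surgery u2 v2 u2' v2' ->
  marked_iso u1' v1' u2' v2' -> marked_iso u1 v1 u2 v2.
Proof.
case=> [stc1 unu1 unv1 i1] [stc2 unu2 unv2 /marked_iso_sym i2] i3.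
have [f [isof fu fv]] := marked_iso_trans (marked_iso_trans i1 i3) i2.
exists f; split=> //; have [bf fa fl] := isof; split=> //.
have injf := bij_inj bf.
move=> x y; have ret : @is_retic n N2 (f y) = @is_retic n N1 y.
  have [_ _ e2 _] := swap_type stc2 unu2 unv2 (f y).
  have [_ _ e1 _] := swap_type stc1 unu1 unv1 y.
  exact: etrans (esym e2) (etrans (@iso_map_retic n _ _ f y isof) e1).
have [ry|nry] := boolP (@is_retic n N1 y); last first.
  by have := fa x y; rewrite /= ret (negbTE nry).
have ft : f (tperm u1 v1 x) = tperm u2 v2 (f x).
  by rewrite -fu -fv; apply: inj_tperm injf.
by have := fa (tperm u1 v1 x) y; rewrite /= ret ry ft !tpermK.
Qed.

(** * Switching at a free leaf *)

Lemma card_option_pred (T : finType) (P : pred (option T)) :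
  #|P| = P None + #|[pred x | P (Some x)]|.
Proof.
rewrite (cardD1 None); congr (_ + _).
have si : injective (@Some T) by move=> u v [].
rewrite -(fintype.card_image si); apply: eq_card => -[x|].
  by rewrite fintype.mem_image ?inE.
by rewrite !inE; apply/esym/negP => /fintype.imageP[].
Qed.

(** * Ancestors of a free leaf *)

Section Incomparable.
Variables (n : nat) (N : lnet n).
Notation V := 'I_(order N).
Hypothesis stc : simplex_tree_child N.

(** The only proper descendant of a reticulation is its leaf, which is not free. *)
Lemma free_leaf_ancestor (z y : V) : free_leaf y -> connect (@arc n N) z y ->
  is_retic z = false.
Proof.
case/andP=> ly /existsPn nr /connectP[[|w p] /=].
  by move=> _ <-; case: (vtypeP stc y) ly.
move=> /andP[zw pth] ey; apply/negP => rz.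
have lw := retic_child stc rz zw.
case: p pth ey => [_ /= ey|x p /=]; last by rewrite (leaf_out stc _ lw).
by have := nr z; rewrite rz ey zw.
Qed.

(** No ancestor of a free leaf is a reticulation, so all of them have at most one parent and they
    form a chain. *)
Lemma free_leaf_chain (c1 c2 y : V) : free_leaf y ->
  connect (@arc n N) c1 y -> connect (@arc n N) c2 y ->
  connect (@arc n N) c1 c2 || connect (@arc n N) c2 c1.
Proof.
move=> fy c1y /connectP[p pth ey].
elim: p c2 pth ey => [|z p IHp] c2 /= => [_ <-|/andP[c2z pth] ey].
  by rewrite c1y.
have zy : connect (@arc n N) z y by apply/connectP; exists p.
have/orP[c1z|zc1] := IHp z pth ey; last first.
  by rewrite (connect_trans (connect1 c2z) zc1) orbT.
case/connectP: c1z => q; case/lastP: q => [_ /= ez|q x].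
  by rewrite -ez (connect1 c2z) orbT.
rewrite rcons_path last_rcons => /andP[pq lx] ez; rewrite -ez in lx.
have <- : last c1 q = c2.
  apply: in_uniq lx c2z.
  by have := free_leaf_ancestor fy zy; case: (vtypeP stc z).
by apply/orP; left; apply/connectP; exists q.
Qed.

Lemma binary_child (b c : V) : binary b -> arc b c ->
  [/\ is_retic c = false, is_root c = false & indeg c = 1].
Proof.
case/andP=> tb /existsPn nr bc; have := nr c; rewrite bc andbT.
have : 0 < indeg c by apply/card_gt0P; exists b; rewrite inE.
by case: (vtypeP stc c).
Qed.

(** The subtree of [c] will be moved below a new vertex just above [y], which creates no directed
    cycle provided that [c] is not an ancestor of [y]. By the chain property, the two children of
    [b] cannot both be ancestors of [y]. *)
Lemma incomparable_child (b y : V) : binary b -> free_leaf y ->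
  exists2 c, arc b c & ~~ connect (@arc n N) c y.
Proof.
move=> bb fy; have tb : is_tree b by case/andP: bb.
have /card_gt1P[c1 [c2 []]] : 1 < #|[pred w | arc b w]|.
  by rewrite -[#|_|]/(outdeg b); case: (vtypeP stc b) tb.
rewrite !inE => b1 b2 ne.
(* A path from [x] to [z] would enter [z] through its only parent [b] and so close a directed
   cycle. *)
have sep x z : arc b x -> arc b z -> x != z -> ~~ connect (@arc n N) x z.
  move=> bx bz xz; apply: contra (acyc stc bx) => /connectP[p].
  case/lastP: p => [_ ezx|p w]; first by rewrite ezx eqxx in xz.
  rewrite rcons_path last_rcons => /andP[pth lw] ew; rewrite -ew in lw.
  have [_ _ iz] := binary_child bb bz.
  have <- : last x p = b by apply: in_uniq lw bz; rewrite iz.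
  by apply/connectP; exists p.
have [c1y|] := boolP (connect (@arc n N) c1 y); last by exists c1.
have [c2y|] := boolP (connect (@arc n N) c2 y); last by exists c2.
have := free_leaf_chain fy c1y c2y.
by rewrite (negbTE (sep _ _ b1 b2 ne)) (negbTE (sep _ _ b2 b1 _)) // eq_sym.
Qed.

End Incomparable.

Lemma SomeSome_inj (T : Type) : injective (fun x : T => Some (Some x)).
Proof. by move=> x y []. Qed.

Section ShiftedRank.
Implicit Types (a b M : nat) (i j k l : bool).

(** Arithmetic of the rank used after regrafting. The flags [k] and [l] tell whether the tail and
    the head of an arc descend from [c]; [i] and [j] tell whether the head is a reticulation or a
    leaf placed last. *)
Lemma shifted_rank_lt a b M i j k l : a < M -> b < M -> a < b -> (k -> l) ->
  (if k then a + M else a) <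
  (if i then 3 * M else if j then (3 * M).+1 else if l then b + M else b).
Proof. by case: i j k l => -[] [] [] => aM bM ab kl; have := kl; lia. Qed.

Lemma shifted_rank_bound a M k : a < M -> (if k then a + M else a) < 3 * M.
Proof. by case: k; lia. Qed.

Lemma shifted_rank_gt a M k : 0 < a -> a < M ->
  M < (if k then (3 * M).+1 else a + M).
Proof. by case: k; lia. Qed.

Lemma triple_gt a M : a < M -> M < 3 * M. Proof. lia. Qed.

End ShiftedRank.

Section Regraft.
Variables (n : nat) (N : lnet n).
Notation V := 'I_(order N).
Variables (b c p y : V).
Notation W := (option (option V)).

(* [Some None] is a new reticulation above the leaf [y]; its parents are [b],
   which gives up its child [c], and a new tree vertex [None], which takes the
   place of [y] below [p] and carries the subtree of [c]. *)
Definition regraft_arc : rel W := fun u v =>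
  match u, v with
  | Some (Some u), Some (Some v) =>
    [&& arc u v, ~~ ((u == b) && (v == c)) & ~~ ((u == p) && (v == y))]
  | Some (Some u), Some None => u == b
  | Some (Some u), None => u == p
  | None, Some None => true
  | None, Some (Some v) => v == c
  | Some None, Some (Some v) => v == y
  | _, _ => false
  end.

Definition regraft_net : lnet n :=
  @LNet n #|{: W}| (fun i j => regraft_arc (enum_val i) (enum_val j))
    (fun i => enum_rank (Some (Some (label N i)))).

Let N' := regraft_net.
Let er (w : W) : 'I_(order N') := enum_rank w.
Let ev (i : 'I_(order N')) : W := enum_val i.

Lemma regraft_ev_bij : bijective ev.
Proof. exact: enum_val_bij. Qed.

Let evK : cancel ev er. Proof. exact: enum_valK. Qed.
Let erK : cancel er ev. Proof. exact: enum_rankK. Qed.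

Hypotheses (stc : simplex_tree_child N) (bb : binary b) (fy : free_leaf y).
Hypotheses (bc : arc b c) (cy : ~~ connect (@arc n N) c y) (py : arc p y).

Lemma regraft_cNy : (c == y) = false.
Proof. by apply: contraNF cy => /eqP->; apply: connect0. Qed.

Definition regraft_in w := #|[pred x | regraft_arc x w]|.
Definition regraft_out w := #|[pred x | regraft_arc w x]|.

Lemma regraft_indeg i : @indeg n N' i = regraft_in (ev i).
Proof. by apply: (card_bij regraft_ev_bij). Qed.

Lemma regraft_outdeg i : @outdeg n N' i = regraft_out (ev i).
Proof. by apply: (card_bij regraft_ev_bij). Qed.

(** [c] trades its parent [b] for [None], and [y] trades [p] for [Some None]. *)
Lemma regraft_in_old v : regraft_in (Some (Some v)) = indeg v.
Proof.
rewrite /regraft_in !card_option_pred /= /indeg.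
have [->|vc] := eqVneq v c.
  rewrite regraft_cNy (cardD1 b [pred u | arc u c]) inE bc; congr (_ + _).
  apply: eq_card => u; rewrite !inE ?andbF ?andbT.
  by case: (u == b); rewrite ?andbF ?andbT.
have [->|vy] := eqVneq v y.
  rewrite (cardD1 p [pred u | arc u y]) inE py; apply: (congr1 succn).
  apply: eq_card => u; rewrite !inE ?andbF ?andbT.
  by case: (u == p); rewrite ?andbF ?andbT.
by apply: eq_card => u; rewrite !inE !andbF !andbT.
Qed.

Lemma regraft_out_old u : regraft_out (Some (Some u)) = outdeg u.
Proof.
rewrite /regraft_out !card_option_pred /= /outdeg.
have [->|ub] := eqVneq u b; have [up|up] := eqVneq _ p.
(* Here [b] and [p] coincide: [c] and [y] are its two children, and both are replaced. *)
- rewrite (cardD1 c [pred w | arc b w]) inE bc.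
  rewrite (cardD1 y [predD1 [pred w | arc b w] & c]) !inE.
  rewrite [y == c]eq_sym regraft_cNy up py; do 2!apply: (congr1 succn).
  apply: eq_card => v; rewrite !inE.
  by case: (v == c); case: (v == y); rewrite ?andbF ?andbT.
- rewrite (cardD1 c [pred w | arc b w]) inE bc; apply: (congr1 succn).
  apply: eq_card => v; rewrite !inE.
  by case: (v == c); rewrite ?andbF ?andbT.
- rewrite up (cardD1 y [pred w | arc p w]) inE py; apply: (congr1 succn).
  apply: eq_card => v; rewrite !inE -up.
  by case: (v == y); rewrite ?andbF ?andbT.
by apply: eq_card => v; rewrite !inE !andbT.
Qed.

Lemma regraft_in_new : (regraft_in None = 1) * (regraft_in (Some None) = 2).
Proof.
have one (z : V) : #|[pred x | x == z]| = 1 by apply: card1.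
by split; rewrite /regraft_in !card_option_pred /= one.
Qed.

Lemma regraft_out_new : (regraft_out None = 2) * (regraft_out (Some None) = 1).
Proof.
have one (z : V) : #|[pred x | x == z]| = 1 by apply: card1.
by split; rewrite /regraft_out !card_option_pred /= one.
Qed.

Lemma regraft_leaf i :
  @is_leaf n N' i = if ev i is Some (Some v) then is_leaf v else false.
Proof.
rewrite -{1}(evK i); case: (ev i) => [[v|]|] /=.
- apply/codomP/codomP => -[j].
    by move/(can_inj erK) => -[->]; exists j.
  by move=> ->; exists j.
- by apply/codomP => -[j] /(can_inj erK).
- by apply/codomP => -[j] /(can_inj erK).
Qed.

Lemma regraft_type i :
  [/\ @is_root n N' i = if ev i is Some (Some v) then is_root v else false,
      @is_tree n N' i = match ev i with Some (Some v) => is_tree v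
                                      | None => true | _ => false end &
      @is_retic n N' i = match ev i with Some (Some v) => is_retic v
                                      | None => false | _ => true end].
Proof.
rewrite /is_root /is_tree /is_retic regraft_indeg regraft_outdeg.
case: (ev i) => [[v|]|]; rewrite ?regraft_in_old ?regraft_out_old ?regraft_in_new ?regraft_out_new //.
Qed.

Lemma regraft_stc : simplex_tree_child N'.
Proof.
have [o ro] := root_exists stc.
have [M rkM] : exists M, forall v : V, rank v < M.
  by exists (order N).+1 => v; rewrite ltnS rank_le.
(* The subtree of [c] moves below [None], hence the shift by [M]; the
   reticulations and the leaves below them come last. *)
pose rk (w : W) := match w with
  | Some (Some v) =>
      if is_retic v then 3 * M else
      if retic_leaf v || (v == y) then (3 * M).+1 else
      if connect (@arc n N) c v then rank v + M else rank v
  | Some None => 3 * M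
  | None => M
  end.
have lf (v : V) : is_leaf v -> forall w, arc v w = false by move=> lv w; apply: leaf_out.
have ly : is_leaf y by case/andP: fy.
have nry (u : V) : arc u y -> is_retic u = false.
  by case/andP: fy => _ /existsPn nr uy; have := nr u; rewrite uy andbT => /negbTE.
have rkin (u v : V) : arc u v -> is_retic u = false ->
    rk (Some (Some u)) = if connect (@arc n N) c u then rank u + M else rank u.
  move=> uv nru; rewrite /rk nru; have nlu : is_leaf u = false.
    by apply/negP => /lf H; rewrite H in uv.
  rewrite /retic_leaf nlu; case: eqP => // euy.
  by rewrite euy ly in nlu.
have [ncr ncro inc] := binary_child stc bb bc.
have tb : is_tree b by case/andP: bb.
have nrb : is_retic b = false by case: (vtypeP stc b) tb.
have rkP w x : regraft_arc w x -> rk w < rk x.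
  case: w => [[u|]|]; case: x => [[v|]|] //=.
  - case/and3P=> uv _ _.
    have [ru|nru] : is_retic u \/ is_retic u = false by case: (is_retic u); auto.
      rewrite ru; have lv := retic_child stc ru uv.
      have -> : is_retic v = false by case: (vtypeP stc v) lv.
      suff -> : retic_leaf v by [].
      by rewrite /retic_leaf lv; apply/existsP; exists u; rewrite ru.
    have /= -> := rkin u v uv nru.
    have ru := rkM u; have rv := rkM v; have ruv := rank_lt stc uv.
    have cuv : connect (@arc n N) c u -> connect (@arc n N) c v.
      by move=> cu; apply: connect_trans cu (connect1 uv).
    exact: shifted_rank_lt.
  - move=> /eqP->; have /= -> := rkin b c bc nrb.
    exact: shifted_rank_bound (rkM b).
  - move=> /eqP->; have /= -> := rkin p y py (nry p py).
    have -> : connect (@arc n N) c p = false.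
      by apply: contraNF cy => cp; apply: connect_trans cp (connect1 py).
    exact: rkM.
  - move=> /eqP->; have -> : is_retic y = false by case: (vtypeP stc y) ly.
    by rewrite eqxx orbT.
  - move=> /eqP->; rewrite ncr regraft_cNy connect0 orbF.
    exact: shifted_rank_gt (rank_gt0 c) (rkM c).
  - by move=> _; apply: triple_gt (rkM o).
apply: (@stc_intro _ N' (er (Some (Some o))) (rk \o ev)).
- by have [-> _ _] := regraft_type (er (Some (Some o))); rewrite erK.
- by move=> u v /rkP.
- move=> i io; rewrite regraft_leaf; have [_ -> ->] := regraft_type i.
  case ei: (ev i) => [[v|]|] //.
  have vo : v != o by apply: contraNneq io => <-; rewrite -ei evK.
  have : @is_root n N v -> v = o by move=> rv; apply: root_unique rv ro.
  case: (vtypeP stc v) => // /(_ isT) eo; by rewrite eo eqxx in vo.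
- by move=> i j /(can_inj erK) [] /(label_inj stc).
- move=> i; rewrite regraft_leaf regraft_indeg regraft_outdeg.
  case: (ev i) => [[v|]|] // lv; rewrite regraft_in_old regraft_out_old; exact: leaf_deg.
- have exW (w : W) i : regraft_arc (ev i) w ->
      (match w with Some (Some v) => is_tree v || is_leaf v
                                      | None => true | _ => false end) ->
      exists j, arc i j && (is_tree j || @is_leaf n N' j).
    move=> iw tw; exists (er w); have [_ -> _] := regraft_type (er w).
    rewrite regraft_leaf /= -/(ev i) -/(ev (er w)) erK iw /=.
    by case: w tw {iw} => [[v|]|].
  move=> i; rewrite regraft_leaf; case ei: (ev i) => [[u|]|] nl.
  + have [up|up] := eqVneq u p.
      by apply: (exW None) => //; rewrite ei /= up.
    (* [b] has lost [c], but its other child is no reticulation, because [b] is binary. *)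
    have [ub|ub] := eqVneq u b.
      have [|w bw wc] := @card2_other _ [pred w | arc b w] c.
        by rewrite -[#|_|]/(outdeg b); case: (vtypeP stc b) tb.
      rewrite /= in bw; apply: (exW (Some (Some w))).
        by rewrite ei /= ub bw (negbTE wc) andbF -ub (negbTE up).
      have [] := binary_child stc bb bw; by case: (vtypeP stc w).
    have [w /andP[uw tw]] := tree_child stc nl.
    apply: (exW (Some (Some w))) => //.
    by rewrite ei /= uw (negbTE up) (negbTE ub).
  + by apply: (exW (Some (Some y))); rewrite ?ei /= ?ly ?orbT.
  + by apply: (exW (Some (Some c))); rewrite ?ei /= ?eqxx //;
      case: (vtypeP stc c) ncr ncro.
- move=> i j; rewrite regraft_leaf; have [_ _ ->] := regraft_type i.
  rewrite /= -/(ev i) -/(ev j).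
  case: (ev i) => [[u|]|]; case: (ev j) => [[v|]|] //=.
  + by move=> ru /and3P[uv _ _]; apply: retic_child uv.
  + by move=> ru /eqP ub; rewrite ub nrb in ru.
  + by move=> ru /eqP up; rewrite up nry in ru.
  + by move=> _ /eqP->.
Qed.

Lemma regraft_near : er None \in @ball n N' 1 (er (Some None)).
Proof.
apply: ball_step (ball_center 0 _) _.
by rewrite /adj /er /= !enum_rankK.
Qed.

End Regraft.

(** The marks are the two new vertices; [b], [c], [p] and [y] are recovered as their neighbours. *)
Definition regraft_surgery n (N : lnet n) (b y : 'I_(order N)) (N' : lnet n)
    (u' v' : 'I_(order N')) :=
  exists c p : 'I_(order N), [/\ arc b c, arc p y, (c == y) = false &
      @marked_iso n (regraft_net b c p y) (enum_rank (Some None)) (enum_rank None) N' u' v'].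

Lemma regraft_arcE n (N : lnet n) (b c p y : 'I_(order N)) u v :
  arc b c -> arc p y ->
  arc u v = [|| regraft_arc b c p y (Some (Some u)) (Some (Some v)),
    (u == b) && (v == c) | (u == p) && (v == y)].
Proof.
move=> bc py /=; have [/andP[/eqP-> /eqP->]|_] := boolP ((u == b) && _).
  by rewrite bc orbT.
have [/andP[/eqP-> /eqP->]|_] := boolP ((u == p) && (v == y)).
  by rewrite py.
by rewrite andbT !orbF.
Qed.

(** An isomorphism respecting the two new vertices restricts to the old ones, matches the neighbours
    [b], [c], [p], [y] of the new vertices, and hence also the two arcs that were removed. *)
Lemma regraft_surgeryK n (N1 : lnet n) (u1 v1 : 'I_(order N1)) N1'
    (u1' v1' : 'I_(order N1')) (N2 : lnet n) (u2 v2 : 'I_(order N2)) N2'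
    (u2' v2' : 'I_(order N2')) :
  regraft_surgery u1 v1 u1' v1' -> regraft_surgery u2 v2 u2' v2' ->
  marked_iso u1' v1' u2' v2' -> marked_iso u1 v1 u2 v2.
Proof.
case=> c1 [p1 [bc1 py1 _ i1]] [c2 [p2 [bc2 py2 _ /marked_iso_sym i2]]] i3.
have [f [isof fr fq]] := marked_iso_trans (marked_iso_trans i1 i3) i2.
have [g isog [fK gK]] := iso_map_inv isof.
(* Restriction to the old vertices, stated for arbitrary regraftings because it is applied to [f]
   and to its inverse. *)
have fold (M1 M2 : lnet n) (b1 c1' p1' y1 : 'I_(order M1))
    (b2 c2' p2' y2 : 'I_(order M2))
    (h : 'I_(order (regraft_net b1 c1' p1' y1)) -> 'I_(order (regraft_net b2 c2' p2' y2))) :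
    injective h -> h (enum_rank (Some None)) = enum_rank (Some None) ->
    h (enum_rank None) = enum_rank None ->
    exists k : 'I_(order M1) -> 'I_(order M2),
      forall u, h (enum_rank (Some (Some u))) = enum_rank (Some (Some (k u))).
  move=> injh hr hq.
  suff H u : exists v, h (enum_rank (Some (Some u))) = enum_rank (Some (Some v)).
    by have [k kP] := choice H; exists k.
  case e: (enum_val (h (enum_rank (Some (Some u))))) => [[v|]|].
  - by exists v; rewrite -e enum_valK.
  - move: e => /(congr1 enum_rank); rewrite enum_valK -hr.
    by move/injh/enum_rank_inj.
  - move: e => /(congr1 enum_rank); rewrite enum_valK -hq.
    by move/injh/enum_rank_inj.
have injf := can_inj fK; have injg := can_inj gK.
have [k kP] := fold _ _ _ _ _ _ _ _ _ _ f injf fr fq.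
have gr : g (enum_rank (Some None)) = enum_rank (Some None) by rewrite -fr fK.
have gq : g (enum_rank None) = enum_rank None by rewrite -fq fK.
have [l lP] := fold _ _ _ _ _ _ _ _ _ _ g injg gr gq.
have kK : cancel k l.
  by move=> u; apply: SomeSome_inj; apply: enum_rank_inj; rewrite -lP -kP fK.
have lK : cancel l k.
  by move=> u; apply: SomeSome_inj; apply: enum_rank_inj; rewrite -kP -lP gK.
have [_ fa fl] := isof.
have ra s t : regraft_arc u1 c1 p1 v1 s t =
    regraft_arc u2 c2 p2 v2 (enum_val (f (enum_rank s))) (enum_val (f (enum_rank t))).
  by have := fa (enum_rank s) (enum_rank t); rewrite /= !enum_rankK.
have kb u : (u == u1) = (k u == u2).
  by have := ra (Some (Some u)) (Some None); rewrite kP fr !enum_rankK.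
have kp u : (u == p1) = (k u == p2).
  by have := ra (Some (Some u)) None; rewrite kP fq !enum_rankK.
have kc v : (v == c1) = (k v == c2).
  by have := ra None (Some (Some v)); rewrite kP fq !enum_rankK.
have ky v : (v == v1) = (k v == v2).
  by have := ra (Some None) (Some (Some v)); rewrite kP fr !enum_rankK.
exists k; split; last 2 first.
- by apply/eqP; rewrite -kb.
- by apply/eqP; rewrite -ky.
split; first by exists l.
  move=> u v; rewrite (regraft_arcE u v bc1 py1) (regraft_arcE (k u) (k v) bc2 py2).
  by rewrite ra !kP !enum_rankK kb kp kc ky.
move=> i; have /= := fl i; rewrite kP => /enum_rank_inj.
by case.
Qed.

(** * Local isomorphisms and balls *)

Definition dadj (X : mdigraph) (x y : X) := edge x y \/ edge y x.

(** The condition of a covering map at [x]: edges lift in both directions, and the map is injective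
    on all neighbours together, in-neighbours and out-neighbours alike. *)
Definition local_iso (X Y : mdigraph) (f : X -> Y) (x : X) :=
  [/\ mark (f x) = mark x,
      forall x', (edge x x' -> edge (f x) (f x')) /\
                 (edge x' x -> edge (f x') (f x)),
      forall y, edge (f x) y -> exists2 x', edge x x' & f x' = y,
      forall y, edge y (f x) -> exists2 x', edge x' x & f x' = y
    & forall x1 x2, dadj x x1 -> dadj x x2 -> f x1 = f x2 -> x1 = x2].

Lemma dist_leW (X : mdigraph) r s (x y : X) :
  r <= s -> dist_le r x y -> dist_le s x y.
Proof.
move=> /subnKC <-; elim: (s - r) => [|k IHk]; first by rewrite addn0.
by rewrite addnS => /IHk; left.
Qed.

Section Covering.
Variables (X Y : mdigraph) (f : X -> Y) (x0 : X) (r : nat).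
Hypothesis loc : forall x, dist_le r.+1 x0 x -> local_iso f x.
Hypothesis no_loop : forall y : Y, ~ edge y y.
Hypothesis no_cycle : forall (w : nat -> Y) l, 2 < l <= 2 * r.+1 -> w l = w 0 ->
  (forall i, i < l -> dadj (w i) (w i.+1)) ->
  (forall i j, i < j < l -> w i <> w j) ->
  (forall i, i <= l -> dist_le r.+1 (f x0) (w i)) -> False.

Let B x := dist_le r.+1 x0 x.

Lemma local_iso_adj x y : B x -> dadj x y -> dadj (f x) (f y).
Proof.
by move=> /loc[_ H _ _ _]; have [H1 H2] := H y; case=> [/H1|/H2]; [left|right].
Qed.

Lemma covering_dist s x : s <= r.+2 -> dist_le s x0 x -> dist_le s (f x0) (f x).
Proof.
elim: s x => [|s IHs] x ls /=; first by move->.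
case=> [dx|[w dw aw]]; first by left; apply: IHs => //; apply: ltnW.
right; exists (f w); first by apply: IHs => //; apply: ltnW.
have Bw : B w by apply: dist_leW dw.
exact: local_iso_adj.
Qed.

Lemma covering_lift s y : s <= r.+1 -> dist_le s (f x0) y ->
  exists2 x, dist_le s x0 x & f x = y.
Proof.
elim: s y => [|s IHs] y ls /=; first by move=> <-; exists x0.
have le : s <= r.+1 by apply: ltnW.
case=> [/(IHs _ le)[x dx <-]|[w /(IHs _ le)[x dx <-] aw]].
  by exists x => //; left.
have /loc[_ _ oe ie _] : B x by apply: dist_leW dx.
case: aw => [/oe|/ie] [x' xx' <-]; exists x' => //; right; exists x => //.
  by left.
by right.
Qed.

Definition walk l (x y : X) (w : nat -> X) :=
  [/\ w 0 = x, w l = y, forall i, i < l -> dadj (w i) (w i.+1)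
    & forall i, i <= l -> B (w i)].

Lemma walk_from_root s x : s <= r.+1 -> dist_le s x0 x ->
  exists l w, l <= s /\ walk l x0 x w.
Proof.
elim: s x => [|s IHs] x ls /=.
  by move=> <-; exists 0, (fun=> x0); do !split=> //; move=> i _; apply: dist_le_refl.
have le : s <= r.+1 by apply: ltnW.
case=> [/(IHs _ le)[l [w [ll W]]]|[y dy xy]].
  by exists l, w; split=> //; apply: leqW.
have [l [w [ll [w0 wl wa wB]]]] := IHs _ le dy.
exists l.+1, (fun i => if i <= l then w i else x); split=> //; split=> //.
- by rewrite ltnn.
- move=> i; rewrite ltnS => il; rewrite il.
  have [lt|ge] := ltnP i l; first exact: wa.
  by have -> : i = l by [lia]; rewrite wl; case: xy; [left|right].
- move=> i _; case: ifP => [/wB //|_].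
  apply: (@dist_leW _ s.+1) => //; right; exists y => //.
Qed.

(** Both vertices are joined to [x0] within distance [r.+1]; the first walk is traversed
    backwards. *)
Lemma walk_between x y : B x -> B y -> exists l w, l <= 2 * r.+1 /\ walk l x y w.
Proof.
move=> /walk_from_root[//|a [u [la [u0 ua uA uB]]]].
move=> /walk_from_root[//|b [v [lb [v0 vb vA vB]]]].
exists (a + b), (fun i => if i <= a then u (a - i) else v (i - a)).
split; first by lia.
split.
- by rewrite subn0.
- case: ifP => [le|_]; last by rewrite addKn.
  have b0 : b = 0 by lia.
    by rewrite b0 addn0 subnn u0 -v0 -vb b0.
- move=> i li; case: (ltngtP i a) => [lt|gt|ia].
  + rewrite -[a - i]subSS subSn //.
    by case: (uA (a - i.+1)); [lia|right|left].
  + by rewrite subSn ?(ltnW gt) //; apply: vA; lia.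
  + rewrite ia subSnn subnn u0 -v0; apply: vA; lia.
- by move=> i li; case: ifP => _; [apply: uB|apply: vB]; lia.
Qed.

(* Among the walks in the ball between distinct vertices with the same image,
   a shortest one has no further coincidence between the images of its
   vertices: its image is a cycle. *)
Lemma covering_inj x y : B x -> B y -> f x = f y -> x = y.
Proof.
move=> Bx By fxy; apply: contrapT => xy.
pose Q l := `[< l <= 2 * r.+1 /\ exists x y w, [/\ walk l x y w, f x = f y & x <> y] >].
have exQ : exists l, Q l.
  have [l [w [ll W]]] := walk_between Bx By.
  by exists l; apply/asboolP; split=> //; exists x, y, w.
case: (ex_minnP exQ) => l /asboolP[ll [{Bx By fxy xy}x [{}y [w [[w0 wl wA wB] fxy xy]]]]] minl.
(* If [w i] and [w j] differ, the walk between them is a shorter example; if they are equal, cutting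
   out the part between them gives one. *)
have inj i j : i < j -> j <= l -> j - i < l -> f (w i) <> f (w j).
  move=> ij jl jil fij.
  have [eij|nij] := pselect (w i = w j); last first.
    suff /minl : Q (j - i) by lia.
    apply/asboolP; split; first by lia.
    exists (w i), (w j), (fun k => w (i + k)); split=> //; split=> //.
    - by rewrite addn0.
    - by rewrite subnKC // ltnW.
    - by move=> k lk; rewrite addnS; apply: wA; lia.
    - by move=> k lk; apply: wB; lia.
  suff /minl : Q (l - (j - i)) by lia.
  apply/asboolP; split; first by lia.
  exists x, y, (fun k => if k <= i then w k else w (k + (j - i))).
  split=> //; split=> //.
  - case: ifP => [le|_]; last by rewrite subnK // ltnW.
    have -> : l - (j - i) = i by lia.
    by rewrite eij -wl; congr w; lia.
  - move=> k lk; case: (ltngtP k i) => [lt|gt|ki].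
    + by apply: wA; lia.
    + by rewrite addSn; apply: wA; lia.
    + by rewrite ki eij addSn subnKC 1?ltnW //; apply: wA; lia.
  - by move=> k lk; case: ifP => _; apply: wB; lia.
(* Length 1 would give a loop in the image, and length 2 would contradict injectivity on the
   neighbours of [w 1]. *)
have l2 : 2 < l.
  case: l {ll minl inj} wl wA wB => [|[|[|//]]] wl wA wB.
  - by case: xy; rewrite -w0 -wl.
  - have : dadj (f (w 0)) (f (w 1)) by apply: local_iso_adj; [apply: wB|apply: wA].
    by rewrite w0 wl fxy; case=> /no_loop.
  - have /loc[_ _ _ _ H] : B (w 1) by apply: wB.
    case: xy; rewrite -w0 -wl; apply: H; rewrite ?w0 ?wl //.
      by rewrite -w0; case: (wA 0 isT); [right|left].
    by rewrite -wl; apply: wA.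
apply: (@no_cycle (f \o w) l) => /=.
- by rewrite l2.
- by rewrite wl w0.
- by move=> i il; apply: local_iso_adj; [apply: wB; apply: ltnW|apply: wA].
- by move=> i j /andP[ij jl]; apply: inj => //; [apply: ltnW|lia].
- by move=> i il; apply: (@covering_dist r.+1 _ (leqnSn _) (wB _ il)).
Qed.

Lemma covering_iso : rmiso (ball_graph r x0) (ball_graph r (f x0)).
Proof.
have up x : dist_le r x0 x -> B x by apply: dist_leW.
pose g (u : {x | dist_le r x0 x}) : {y | dist_le r (f x0) y} :=
  exist _ (f (sval u)) (covering_dist (leqW (leqnSn r)) (svalP u)).
have sgE (T : Type) (P : T -> Prop) (u v : {x | P x}) : sval u = sval v -> u = v.
  by case: u v => [u pu] [v pv] /= e; case: v / e pv => pv; congr exist; apply: Prop_irrelevance.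
exists g; split.
- have injg : injective g.
    move=> u v /(congr1 sval) /= e; apply: sgE.
    by apply: covering_inj => //; apply: up; apply: svalP.
  have surg v : exists u, g u = v.
    have [x dx fx] := covering_lift (leqnSn r) (svalP v).
    by exists (exist _ x dx); apply: sgE.
  have [h hP] := choice surg.
  by exists h => // u; apply: injg.
- move=> u v /=; have [_ H oe _ _] := loc (up _ (svalP u)).
  split; first by case: (H (sval v)).
  move=> /oe[x ux fx]; suff <- : x = sval v by [].
  (* The lifted endpoint is only known to be within distance [r.+1]; this is why injectivity is
     proved on a ball larger by one. *)
  apply: covering_inj fx; last by apply: up; apply: svalP.
  right; exists (sval u); [exact: svalP|by left].
- by move=> u /=; have [] := loc (up _ (svalP u)).
- by apply: sgE.
Qed.

End Covering.

(** * Short cycles contain bad vertices *)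

Section Cycles.
Variables (n : nat) (N : lnet n).
Notation V := 'I_(order N).
Hypothesis stc : simplex_tree_child N.

Lemma two_parents (p q rho : V) : p != q -> arc p rho -> arc q rho -> is_retic rho.
Proof.
move=> pq pr qr; have iu := @in_uniq _ _ rho p q.
have : 0 < indeg rho by apply/card_gt0P; exists p; rewrite inE.
case: (vtypeP stc rho) iu => // iu _; by rewrite (iu isT pr qr) eqxx in pq.
Qed.

(* Both neighbours on the cycle of a vertex of maximal rank are its parents. *)
Lemma cycle_bad (w : nat -> V) l L : 2 < l <= L -> w l = w 0 ->
  (forall i, i < l -> adj (w i) (w i.+1)) ->
  (forall i j, i < j < l -> w i <> w j) ->
  exists2 i, i < l & bad L (w i).
Proof.
case/andP=> l2 lL wl wA winj.
have l0 : 0 < l by apply: leq_ltn_trans l2.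
(* The cycle is continued periodically, so that it can be read starting from any of its vertices. *)
pose y k := w (k %% l).
have yA k : adj (y k) (y k.+1).
  rewrite /y; have := ltn_pmod k l0.
  rewrite -[k.+1]addn1 -[in X in _ -> X]modnDml addn1; move: (k %% l) => m ml.
  have := wA m ml; have [el|ne] := eqVneq m.+1 l.
    by rewrite el wl modnn.
  by rewrite modn_small // ltn_neqAle ne.
have yinj i j : i < j < i + l -> y i <> y j.
  case/andP=> ij jl; rewrite /y => e.
  have [li lj] := (ltn_pmod i l0, ltn_pmod j l0).
  have emod : i = j %[mod l].
    case: (ltngtP (i %% l) (j %% l)) => // lt; exfalso.
      by apply: (winj _ _ _ e); rewrite lt.
    by apply: (winj _ _ _ (esym e)); rewrite lt.
  have : l <= j - i.
    apply: dvdn_leq; first by rewrite subn_gt0.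
    by rewrite -eqn_mod_dvd ?(ltnW ij) //; apply/eqP.
  by rewrite leqNgt ltn_subLR ?jl // ltnW.
case: (@arg_maxnP _ (Ordinal l0) xpredT (fun i : 'I_l => rank (w i))) => // i _ maxi.
have rmax k : rank (y k) <= rank (y i).
  have := maxi (Ordinal (ltn_pmod k l0)) isT.
  by rewrite /y [i %% l]modn_small.
have sink k : adj (y i) (y k) -> arc (y k) (y i).
  by case/orP=> // /(rank_lt stc); rewrite ltnNge rmax.
(* The cycle without its vertex [y i] of maximal rank: [p] followed by the [l - 2] vertices of [s],
   ending at the predecessor of [y i]. *)
pose p := y i.+1; pose s := [seq y (i.+2 + k) | k <- iota 0 (l - 2)].
have szs : size s = l - 2 by rewrite size_map size_iota.
have nthE k : k <= l - 2 -> nth p (p :: s) k = y (i.+1 + k).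
  case: k => [|k] lk /=; first by rewrite addn0.
  rewrite (nth_map 0) ?size_iota // nth_iota // add0n; congr y; lia.
have lastE : last p s = y (i.+1 + (l - 2)).
  by rewrite -nthE // -szs -[last p s]/(last p (p :: s)) -nth_last.
have arcp : arc p (y i) by apply: sink; apply: yA.
have arcq : arc (last p s) (y i).
  rewrite lastE; apply: sink; rewrite adj_sym.
  have -> : y i = y (i.+1 + (l - 2)).+1.
    by rewrite /y; congr w; rewrite -[LHS]modnDr; congr (_ %% _); lia.
  exact: yA.
have pq : last p s != p.
  by rewrite lastE eq_sym; apply/eqP; apply: yinj; lia.
exists (i.+1 %% l); first exact: ltn_pmod.
apply/asboolP; exists (y i), s; split=> //.
  by rewrite eq_sym in pq; apply: two_parents pq arcp arcq.
split; last by rewrite szs; lia.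
  apply/(pathP p) => k; rewrite szs => kl.
  change (adj (nth p (p :: s) k) (nth p (p :: s) k.+1)).
  by rewrite (nthE _ (ltnW kl)) (nthE _ kl) addnS; apply: yA.
apply/mapP => -[k]; rewrite mem_iota => /andP[_ kl].
by apply: yinj; lia.
Qed.

End Cycles.

(** * The network around a vertex without defects nearby *)

Section LocalStructure.
Variables (n : nat) (N : lnet n).
Notation V := 'I_(order N).
Hypothesis stc : simplex_tree_child N.
Implicit Types u w : V.

Definition defect u := [|| is_root u, free_leaf u | binary u].

(* Each of these is [u] itself when there is no such vertex. *)
Definition up u := odflt u [pick w | arc w u].
Definition down u := odflt u [pick w | arc u w && is_tree w].
Definition hyb u := odflt u [pick w | arc u w && is_retic w].
Definition partner u := odflt u [pick w | arc w (hyb u) && (w != u)].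
Definition child u := odflt u [pick w | arc u w].

(** Neighbours are included in order to exclude the root as a parent and free leaves as children. *)
Definition regular u := [forall w, (w \in ball 1 u) ==> ~~ defect w].

Lemma regular_self u : regular u -> ~~ defect u.
Proof. by move=> /forallP/(_ u); rewrite ball_center. Qed.

Lemma regular_adj u w : regular u -> adj u w -> ~~ defect w.
Proof.
by move=> /forallP/(_ w) /implyP H uw; apply: H; apply: ball_step (ball_center 0 u) uw.
Qed.

Lemma upE u w : is_tree u -> arc w u -> up u = w.
Proof.
move=> tu wu; rewrite /up; case: pickP => [x xu|/(_ w)]; last by rewrite wu.
by apply: in_uniq xu wu; case: (vtypeP stc u) tu.
Qed.

Lemma hybE u w : arc u w -> is_retic w -> hyb u = w.
Proof.
move=> uw rw; rewrite /hyb; case: pickP => [x /andP[ux rx]|/(_ w)].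
  exact: (retic_child_uniq stc rx rw ux uw).
by rewrite uw rw.
Qed.

Lemma childE u w : is_retic u -> arc u w -> child u = w.
Proof.
move=> ru uw; rewrite /child; case: pickP => [x ux|/(_ w)]; last by rewrite uw.
by apply: out_uniq ux uw; case: (vtypeP stc u) ru.
Qed.

Lemma child_spec u : is_retic u -> [/\ arc u (child u), is_leaf (child u)
   & forall w, arc u w = (w == child u)].
Proof.
move=> ru; have [w uw] := retic_has_child stc ru.
rewrite (childE ru uw); split=> //; first exact: retic_child uw.
by move=> x; apply/idP/eqP => [ux|-> //]; rewrite -(childE ru ux) (childE ru uw).
Qed.

Lemma arc_root w u : arc w u -> is_root u = false.
Proof.
move=> wu; have : 0 < indeg u by apply/card_gt0P; exists w; rewrite inE.
by case: (vtypeP stc u).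
Qed.

Lemma tree_parent p u : is_tree u -> arc p u -> ~~ is_root p -> is_tree p.
Proof.
move=> tu pu nrt.
have nrp : is_retic p = false.
  by apply/negP => rp; have := retic_child stc rp pu; case: (vtypeP stc u) tu.
have nlp : is_leaf p = false.
  by apply/negP => lp; rewrite (leaf_out stc _ lp) in pu.
by case: (vtypeP stc p) nrt nrp nlp.
Qed.

(** One child is a reticulation, as [u] is not binary. The other is not a second reticulation, by
    uniqueness, nor a leaf, which would be free; so it is a tree vertex. *)
Lemma regular_tree u : is_tree u -> regular u ->
  [/\ is_tree (up u), is_tree (down u) & is_retic (hyb u)] /\
  [/\ forall w, arc w u = (w == up u), arc u (down u), arc u (hyb u) &
      forall w, arc u w = (w == down u) || (w == hyb u)].
Proof.
move=> tu ru.
have [p pu] := tree_has_parent stc tu.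
have iu w : arc w u = (w == up u).
  by apply/idP/eqP => [/(upE tu)->|->] //; rewrite (upE tu pu).
have tup : is_tree (up u).
  rewrite (upE tu pu); apply: (tree_parent tu pu).
  have : ~~ defect p by apply: regular_adj ru _; rewrite /adj pu orbT.
  by rewrite /defect; case: is_root.
have : ~~ defect u by apply: regular_self.
rewrite /defect /binary tu !negb_or negbK => /and3P[_ _ /existsP[h /andP[rh uh]]].
have eh := hybE uh rh.
have out2 : outdeg u = 2 by case: (vtypeP stc u) tu.
have [|w uw wh] := @card2_other _ [pred w | arc u w] h.
  by rewrite -[#|_|]/(outdeg u) out2.
rewrite /= in uw.
have out w' : arc u w' = (w' == w) || (w' == h).
  by apply: (@card2_predE _ [pred w | arc u w]); rewrite // -[#|_|]/(outdeg u) out2.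
have nrw : is_retic w = false.
  by apply: contraNF wh => rw; rewrite -(hybE uw rw) eh.
have nlw : is_leaf w = false.
  apply/negP => lw.
  have : ~~ defect w by apply: regular_adj ru _; rewrite /adj uw.
  rewrite /defect /free_leaf lw !negb_or negbK.
  case/and3P=> _ /existsP[x /andP[rx xw]] _.
  have xu : x = u by apply: in_uniq xw uw; case: (vtypeP stc w) lw.
  by move: rx; rewrite xu; case: (vtypeP stc u) tu.
have tw : is_tree w.
  by move: (arc_root uw) nrw nlw; case: (vtypeP stc w).
have ed : down u = w.
  rewrite /down; case: pickP => [x|/(_ w)]; last by rewrite uw tw.
  rewrite out => /andP[/orP[/eqP->//|/eqP->]].
  by case: (vtypeP stc h) rh.
by rewrite ed eh.
Qed.

Lemma regular_hyb u : is_tree u -> regular u ->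
  [/\ is_tree (partner u), partner u != u, arc (partner u) (hyb u) &
      forall w, arc w (hyb u) = (w == u) || (w == partner u)].
Proof.
move=> tu ru; have [[_ _ rh] [_ _ uh _]] := regular_tree tu ru.
have in2 : indeg (hyb u) = 2 by case: (vtypeP stc (hyb u)) rh.
have [|q qh qu] := @card2_other _ [pred w | arc w (hyb u)] u.
  by rewrite -[#|_|]/(indeg (hyb u)) in2.
rewrite /= in qh.
have out w' : arc w' (hyb u) = (w' == u) || (w' == q).
  apply: (@card2_predE _ [pred w | arc w (hyb u)]); rewrite // 1?eq_sym //.
  by rewrite -[#|_|]/(indeg (hyb u)) in2.
have eq : partner u = q.
  rewrite /partner; case: pickP => [x|/(_ q)]; last by rewrite qh qu.
  by rewrite out => /andP[/orP[/eqP->|/eqP->//]]; rewrite eqxx.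
by rewrite eq; split=> //; apply: retic_parent qh.
Qed.

Lemma hyb_partner u : is_tree u -> regular u -> hyb (partner u) = hyb u.
Proof.
move=> tu ru; have [_ _ ph _] := regular_hyb tu ru.
by apply: hybE => //; have [[]] := regular_tree tu ru.
Qed.

Lemma downE u w : is_tree u -> is_tree w -> regular w -> arc w u -> down w = u.
Proof.
move=> tu tw rw; have [[_ _ rh] [_ _ _ ->]] := regular_tree tw rw.
case/orP=> /eqP eu //; by move: rh; rewrite -eu; case: (vtypeP stc u) tu.
Qed.

Lemma adj_up u : is_tree u -> regular u -> adj u (up u).
Proof.
by move=> tu ru; have [_ [iu _ _ _]] := regular_tree tu ru; rewrite /adj iu eqxx orbT.
Qed.

Lemma adj_down u : is_tree u -> regular u -> adj u (down u).
Proof. by move=> tu ru; have [_ [_ du _ _]] := regular_tree tu ru; rewrite /adj du. Qed.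

Lemma adj_hyb u : is_tree u -> regular u -> adj u (hyb u).
Proof. by move=> tu ru; have [_ [_ _ du _]] := regular_tree tu ru; rewrite /adj du. Qed.

Section Chart.
Variables (v : V) (K : nat).
Hypothesis zone : forall u, u \in ball K v -> regular u.

(** Position [i] on the spine through [u]. [Negz k] stands for [- k.+1], hence the [k.+1] steps
    upwards. *)
Definition shift u (i : int) : V :=
  match i with Posz k => iter k down u | Negz k => iter k.+1 up u end.

Lemma shift_tree u k i : is_tree u -> u \in ball k v -> k + `|i|%N <= K.+1 ->
  is_tree (shift u i) /\ shift u i \in ball (k + `|i|%N) v.
Proof.
have main g j : (forall w, is_tree w -> regular w -> is_tree (g w) /\ adj w (g w)) ->
    is_tree u -> u \in ball k v -> k + j <= K.+1 ->
    is_tree (iter j g u) /\ iter j g u \in ball (k + j) v.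
  move=> gP tu uk; elim: j => [|j IHj]; first by rewrite addn0.
  rewrite addnS => kj; have [tj bj] := IHj (ltnW kj).
  have rj : regular (iter j g u).
    by apply: zone; apply: (fintype.subsetP (ball_leq v _)) bj; lia.
  have [tg ag] := gP _ tj rj; split=> //; exact: ball_step bj ag.
case: i => j; apply: main => w tw rw; have [[? ? ?] _] := regular_tree tw rw.
  by split=> //; apply: adj_down.
by split=> //; apply: adj_up.
Qed.

Lemma shift_succ u k i : is_tree u -> u \in ball k v -> k + `|i|%N < K.+1 ->
  shift u (i + 1)%R = down (shift u i) /\ shift u (i - 1)%R = up (shift u i).
Proof.
move=> tu uk ki.
have reg j : `|j| <= `|i| -> is_tree (shift u j) /\ regular (shift u j).
  move=> ji; have [|tj bj] := @shift_tree u k j tu uk; first by lia.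
  split=> //; apply: zone; apply: (fintype.subsetP (ball_leq v _)) bj; lia.
case: i ki reg => j ki reg; split.
- by rewrite -PoszD addn1.
- case: j ki reg => [|j] ki reg; first by [].
  rewrite -[j.+1]addn1 PoszD GRing.addrK /=.
  have [tj rj] : is_tree (shift u j) /\ regular (shift u j) by apply: reg; lia.
  have [[_ td _] [_ ad _ _]] := regular_tree tj rj.
  by rewrite addn1 /=; apply/esym/upE.
- have -> : (Negz j + 1 = - Posz j)%R by lia.
  have [tj rj] : is_tree (shift u (- Posz j)) /\ regular (shift u (- Posz j)).
    by apply: reg; lia.
  have e : shift u (Negz j) = up (shift u (- Posz j)) by case: (j).
  rewrite e; apply/esym/downE => //.
  + by have [[]] := regular_tree tj rj.
  + by rewrite -e; have [] := reg (Negz j) (leqnn _).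
  + by have [_ [-> _ _ _]] := regular_tree tj rj; apply: eqxx.
- by have -> : (Negz j - 1 = Negz j.+1)%R by lia.
Qed.

End Chart.
End LocalStructure.

Section LocalIsoIntro.
Variables (n : nat) (N : lnet n) (X : mdigraph) (f : X -> net_graph N).
Let g : X -> 'I_(order N) := f.

Lemma in_map (s : seq X) x : List.In x s -> g x \in map g s.
Proof. by elim: s => //= y s IHs [->|/IHs]; rewrite inE ?eqxx // => ->; rewrite orbT. Qed.

Lemma map_in (s : seq X) w : w \in map g s -> exists2 x, List.In x s & g x = w.
Proof.
elim: s => //= y s IHs; rewrite inE => /orP[/eqP->|/IHs[x xs <-]].
  by exists y; [left|].
by exists x; [right|].
Qed.

Lemma uniq_map_in (s : seq X) x y :
  uniq (map g s) -> List.In x s -> List.In y s -> g x = g y -> x = y.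
Proof.
elim: s => //= z s IHs /andP[zs us] [zx|xs] [zy|ys] e.
- by rewrite -zx.
- by rewrite zx e in_map in zs.
- by rewrite zy -e in_map in zs.
- exact: IHs.
Qed.

(** Lists are compared through their images, where equality is decidable. Uniqueness along the
    concatenation yields injectivity on all neighbours together. *)
Lemma local_iso_intro (x : X) (ins outs : seq X) :
  mark x = net_mark (g x) ->
  (forall y, edge y x <-> List.In y ins) ->
  (forall y, edge x y <-> List.In y outs) ->
  (forall w, arc w (g x) = (w \in map g ins)) ->
  (forall w, arc (g x) w = (w \in map g outs)) ->
  uniq (map g (ins ++ outs)) ->
  local_iso f x.
Proof.
move=> mx ie oe ia oa un; split=> //.
- move=> y; split=> [/oe|/ie] H; apply/idP.
    by change (arc (g x) (g y)); rewrite oa in_map.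
  by change (arc (g y) (g x)); rewrite ia in_map.
- move=> w H; have : arc (g x) w by exact: H.
  by rewrite oa => /map_in[y /oe xy <-]; exists y.
- move=> w H; have : arc w (g x) by exact: H.
  by rewrite ia => /map_in[y /ie xy <-]; exists y.
- move=> x1 x2 a1 a2; apply: uniq_map_in un _ _; apply: List.in_or_app.
    by case: a1 => [/oe|/ie]; auto.
  by case: a2 => [/oe|/ie]; auto.
Qed.

End LocalIsoIntro.

(** * Charts from the limit networks *)

Section SpineStructure.
Variables (B : Type) (D : pred int).
Notation svertex := (svertex B D).
Notation dvertex := (dvertex B D).

Definition sins (w : svertex) : seq svertex :=
  match w with
  | SpineV s i => [:: SpineV s (i - 1)%R]
  | ReticV x => [:: tree_of x; SpineV (New x) 0%R]
  | LeafV x => [:: ReticV x]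
  end.

Lemma sedge_ins (u w : svertex) : sedge u w <-> List.In u (sins w).
Proof.
split.
  case=> [s i|x|x|x] /=; rewrite ?addrK; auto.
case: w => [s i|x|x] /=.
- by case=> // <-; rewrite -[X in sedge _ (SpineV _ X)](subrK 1%R i); constructor.
- by case=> [<-|[<-|//]]; constructor.
- by case=> // <-; constructor.
Qed.

(** In [Rhat] these are the positions 0 of the two base spines, whose reticulation child [Rho0] lies
    outside the recursive part. *)
Definition undecorated (w : svertex) :=
  if w is SpineV (Base _) i then ~~ D i else false.

Lemma tree_of_inj (x y : dvertex) : tree_of x = tree_of y -> x = y.
Proof.
case: x y => [b i Di|x i ni] [c j Dj|y j nj] //= [].
  by move=> -> e; case: j / e Dj => Dj; congr OnBase; apply: bool_irrelevance.
by move=> -> e; case: j / e nj => nj; congr OnNew; apply: bool_irrelevance.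
Qed.

Lemma tree_of_neq (z x : dvertex) : tree_of z <> SpineV (New x) 0%R.
Proof. by case: z => [//|y j nj] [_ j0]; move: nj; rewrite j0. Qed.

(** The reticulation child stems either from the decoration of the vertex itself or, at position 0
    of a spine [New x], from that of [x]. *)
Lemma spine_retic s i : ~~ undecorated (SpineV s i) -> exists z : dvertex,
  (tree_of z = SpineV s i \/ (SpineV (New z) 0%R = SpineV s i :> svertex)) /\
  forall x, sedge (SpineV s i) (ReticV x) <-> x = z.
Proof.
move=> dec.
have [[z ez]|[x0 [-> ->]]] :
    (exists z, tree_of z = SpineV s i) \/ (exists x, s = New x /\ i = 0%R).
- case: s dec => [b|x] /=; first by rewrite negbK => Di; left; exists (OnBase b Di).
  move=> _; have [->|ni] := eqVneq i 0%R; first by right; exists x.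
  by left; exists (OnNew x ni).
- exists z; split; first by left.
  move=> x; rewrite sedge_ins /= -ez; split.
    case=> [/tree_of_inj //|[/esym/tree_of_neq //|//]].
  by move=> ->; left.
- exists x0; split; first by right.
  move=> x; rewrite sedge_ins /=; split; last by move=> ->; right; left.
  by case=> [/tree_of_neq|[[]|]].
Qed.

Definition souts_spec (w : svertex) (l : seq svertex) :=
  forall u, sedge w u <-> List.In u l.

Lemma souts_spine s i : ~~ undecorated (SpineV s i) -> exists z : dvertex,
  (tree_of z = SpineV s i \/ (SpineV (New z) 0%R = SpineV s i :> svertex)) /\
  souts_spec (SpineV s i) [:: SpineV s (i + 1)%R; ReticV z].
Proof.
move=> /spine_retic[z [ez zP]]; exists z; split=> // -[t j|x|x].
- rewrite sedge_ins /=; split=> [[[-> <-]|//]|[[<- <-]|[]//]].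
    by left; rewrite subrK.
  by left; rewrite addrK.
- split=> [/zP->|[//|[[<-]|//]]]; first by right; left.
  exact/zP.
- by rewrite sedge_ins /=; split=> [[]|[|[]]].
Qed.

Lemma souts_retic x : souts_spec (ReticV x) [:: LeafV x].
Proof.
move=> [t j|y|y]; rewrite sedge_ins /=.
- by split=> [[]|[]].
- by split=> [[|[|//]]|[]] //; case: y.
- by split=> [[[->]|//]|[[->]|//]]; left.
Qed.

Lemma souts_leaf x : souts_spec (LeafV x) [::].
Proof.
move=> [t j|y|y]; rewrite sedge_ins /=.
- by split=> [[]|[]].
- by split=> [[|[|//]]|[]] //; case: y.
- by split=> [[]|[]].
Qed.

Variable d0 : nat.

(* Distance to the root of the limit network, when the positions 0 of the base
   spines are at distance [d0] from it. *)
Fixpoint ddepth (x : dvertex) : nat :=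
  match x with
  | OnBase _ i _ => d0 + `|i|
  | OnNew y i _ => ddepth y + 2 + `|i|
  end%N.

Definition spine_depth (s : spine B D) : nat :=
  if s is New x then ddepth x + 2 else d0.

Definition depth (w : svertex) : nat :=
  match w with
  | SpineV s i => spine_depth s + `|i|
  | ReticV x => ddepth x + 1
  | LeafV x => ddepth x + 2
  end%N.

Lemma depth_tree_of x : depth (tree_of x) = ddepth x.
Proof. by case: x. Qed.

Lemma depth_edge u w : sedge u w ->
  (depth u <= (depth w).+1) /\ (depth w <= (depth u).+1).
Proof.
case=> [s i|x|x|x]; rewrite ?depth_tree_of /=; lia.
Qed.

End SpineStructure.

Section ChartMap.
Variables (n : nat) (N : lnet n).
Notation V := 'I_(order N).
Hypothesis stc : simplex_tree_child N.
Variables (v : V) (K : nat).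
Hypothesis zone : forall u, u \in ball K v -> regular u.
Variables (B : Type) (D : pred int) (base : B -> V) (d0 : nat).
Hypothesis baseP : forall b, is_tree (base b) /\ base b \in ball d0 v.
Hypothesis d0K : d0 <= K.
Notation svertex := (svertex B D).
Notation dvertex := (dvertex B D).
Notation ddepth := (@ddepth B D d0).
Notation spine_depth := (@spine_depth B D d0).
Notation depth := (@depth B D d0).

Lemma tree_neq_retic (a b : V) : is_tree a -> is_retic b -> a != b.
Proof. by move=> ta rb; apply: contraTneq rb => <-; case: (vtypeP stc a) ta. Qed.

Lemma tree_neq_leaf (a b : V) : is_tree a -> is_leaf b -> a != b.
Proof. by move=> ta lb; apply: contraTneq lb => <-; case: (vtypeP stc a) ta. Qed.

(** The chart follows the recursive construction: the spine created by [y] is laid along the spine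
    through the second parent of the reticulation below the image of [y]. *)
Fixpoint dchart (x : dvertex) : V :=
  match x with
  | OnBase b i _ => shift (base b) i
  | OnNew y i _ => shift (partner (dchart y)) i
  end.

Definition center (s : spine B D) : V :=
  match s with Base b => base b | New x => partner (dchart x) end.

Definition chart (w : svertex) : V :=
  match w with
  | SpineV s i => shift (center s) i
  | ReticV x => hyb (dchart x)
  | LeafV x => child (hyb (dchart x))
  end.

Lemma chart_tree_of x : chart (tree_of x) = dchart x.
Proof. by case: x. Qed.

Lemma in_zone k u : u \in ball k v -> k <= K -> regular u.
Proof. by move=> uk kK; apply/zone/(fintype.subsetP (ball_leq v kK)). Qed.

Lemma partner_spec k u : is_tree u -> u \in ball k v -> k < K ->
  [/\ regular u, is_tree (partner u) & partner u \in ball k.+2 v].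
Proof.
move=> tu uk kK; have ru : regular u by apply: in_zone uk (ltnW kK).
have hk : hyb u \in ball k.+1 v by apply: ball_step uk (adj_hyb stc tu ru).
have [tp _ ap _] := regular_hyb stc tu ru; split=> //.
by apply: ball_step hk _; rewrite /adj ap orbT.
Qed.

Lemma dchart_tree x : ddepth x <= K.+1 ->
  is_tree (dchart x) /\ dchart x \in ball (ddepth x) v.
Proof.
elim: x => [b i Di|x IHx i ni] /= le.
  by have [tb bb] := baseP b; apply: (shift_tree stc zone).
have [|tx bx] := IHx; first by lia.
have [|_ tp bp] := partner_spec tx bx; first by lia.
rewrite addn2 in le *; exact: (shift_tree stc zone tp bp le).
Qed.

Lemma center_tree s : spine_depth s <= K.+1 ->
  is_tree (center s) /\ center s \in ball (spine_depth s) v.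
Proof.
case: s => [b|x] //= le; have [|tx bx] := @dchart_tree x; first by lia.
have [|_ tp bp] := partner_spec tx bx; first by lia.
by rewrite addn2.
Qed.

Lemma chart_spine s i (u := chart (SpineV s i)) : depth (SpineV s i) <= K ->
  [/\ is_tree u, regular u, chart (SpineV s (i - 1)%R) = up u
    & chart (SpineV s (i + 1)%R) = down u].
Proof.
rewrite /u /= => le; have [|tc bc] := @center_tree s; first by lia.
have [|tu bu] := shift_tree stc zone (i := i) tc bc; first by lia.
have [|e1 e2] := shift_succ stc zone (i := i) tc bc; first by lia.
by split=> //; apply: in_zone bu _.
Qed.

Lemma chart_dec x : depth (ReticV x) <= K ->
  is_tree (dchart x) /\ regular (dchart x).
Proof.
move=> /= le; have [|tx bx] := @dchart_tree x; first by lia.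
by split=> //; apply: in_zone bx _; lia.
Qed.

(** At position 0 of [New z] the image is the partner of the image of [z], and the two share their
    reticulation child. *)
Lemma chart_hyb s i z : depth (SpineV s i) <= K ->
  (tree_of z = SpineV s i \/ (SpineV (New z) 0%R = SpineV s i :> svertex)) ->
  chart (ReticV z) = hyb (chart (SpineV s i)).
Proof.
move=> le [ez|ez]; first by rewrite -ez chart_tree_of.
rewrite -ez /=; rewrite -ez /= in le.
have [|tx rx] := @chart_dec z; first by rewrite /=; lia.
by rewrite (hyb_partner stc tx rx).
Qed.

(* [iota] is the identity for [Lhat] and [Old] for [Rhat]. *)
Variables (X : mdigraph) (iota : svertex -> X) (f : X -> net_graph N).
Hypothesis f_iota : forall w, f (iota w) = chart w.
Hypothesis mark_iota : forall w, mark (iota w) = smark w.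
Hypothesis in_iota : forall y w,
  edge y (iota w) <-> exists2 u, y = iota u & sedge u w.
Hypothesis out_iota : forall y w, ~~ undecorated w ->
  (edge (iota w) y <-> exists2 u, y = iota u & sedge w u).

Lemma in_map_iota y (l : seq svertex) :
  List.In y (map iota l) <-> exists2 u, y = iota u & List.In u l.
Proof.
rewrite List.in_map_iff; split=> [[u [<- ul]]|[u -> ul]]; by exists u.
Qed.

(** The depth bound keeps the relevant tree vertices in the regular zone, where the neighbours of an
    image are exactly the images of the neighbours in the limit. *)
Lemma chart_local w : depth w <= K -> ~~ undecorated w -> local_iso f (iota w).
Proof.
move=> le dec.
have inE' y : edge y (iota w) <-> List.In y (map iota (sins w)).
  by rewrite in_iota in_map_iota; split=> -[u -> H]; exists u => //; apply/sedge_ins.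
have outE l : souts_spec w l -> forall y, edge (iota w) y <-> List.In y (map iota l).
  by move=> lP y; rewrite out_iota // in_map_iota; split=> -[u -> H]; exists u => //; apply/lP.
have mapE l : map (f : X -> V) (map iota l) = map chart l.
  by rewrite -map_comp; apply: eq_map.
case: w le dec inE' outE => [s i|x|x] le dec inE' outE.
- have [z [ez /outE oz]] := souts_spine dec.
  have [tu ru eup edn] := chart_spine le.
  have eh := chart_hyb le ez.
  have [[tup tdn rh] [iu ad ah ou]] := regular_tree stc tu ru.
  apply: (local_iso_intro _ inE' oz).
  + by rewrite mark_iota f_iota /net_mark; case: (vtypeP stc (chart _)) tu.
  + by move=> w; rewrite f_iota mapE iu !inE eup.
  + by move=> w; rewrite f_iota mapE ou !inE edn eh.
  + rewrite -map_cat mapE /sins cat1s /= !inE.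
    rewrite -[shift _ (i - 1)%R]/(chart (SpineV s (i - 1)%R)) eup.
    rewrite -[shift _ (i + 1)%R]/(chart (SpineV s (i + 1)%R)) edn.
    rewrite -[hyb (dchart z)]/(chart (ReticV z)) eh andbT.
    set u := chart _ in tu ru tup tdn rh iu ad ah ou *.
    rewrite (negbTE (tree_neq_retic tup rh)) (tree_neq_retic tdn rh) orbF andbT.
    apply/negP => /eqP e; have : arc u (up u) by rewrite e.
    by rewrite (arc_asym stc) // iu eqxx.
- have oz := outE _ (@souts_retic B D x).
  have [tx rx] := chart_dec le.
  have [[_ _ rr] _] := regular_tree stc tx rx.
  have [tp px ap ih] := regular_hyb stc tx rx.
  have [ac lc oc] := child_spec stc rr.
  apply: (local_iso_intro _ inE' oz).
  + by rewrite mark_iota f_iota /net_mark /=; case: (vtypeP stc (hyb _)) rr.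
  + by move=> w; rewrite f_iota mapE /= ih !inE chart_tree_of.
  + by move=> w; rewrite f_iota mapE /= oc !inE.
  + rewrite -map_cat mapE /= !inE chart_tree_of /= andbT.
    rewrite eq_sym (negbTE px) (negbTE (tree_neq_leaf tx lc)).
    exact: tree_neq_leaf.
- have oz := outE _ (@souts_leaf B D x).
  have [|tx rx] := @chart_dec x; first by move: le => /=; lia.
  have [[_ _ rr] _] := regular_tree stc tx rx.
  have [ac lc oc] := child_spec stc rr.
  apply: (local_iso_intro _ inE' oz).
  + by rewrite mark_iota f_iota /net_mark /= lc.
  + move=> w; rewrite f_iota mapE /= !inE.
    apply/idP/eqP => [wc|-> //]; apply: in_uniq wc ac.
    by case: (vtypeP stc (child _)) lc.
  + by move=> w; rewrite f_iota mapE /= (leaf_out stc).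
  + by [].
Qed.

End ChartMap.

(** A function changing by at most one along edges grows no faster than the distance. *)
Lemma dist_depth (X : mdigraph) (dep : X -> nat) (x0 : X) :
  (forall x y : X, edge x y -> (dep x <= (dep y).+1) /\ (dep y <= (dep x).+1)) ->
  forall s x, dist_le s x0 x -> dep x <= dep x0 + s.
Proof.
move=> depE; elim=> [|s IHs] x /=; first by move=> ->; rewrite addn0.
rewrite addnS => -[/IHs/leqW //|[w /IHs le]].
by case=> /depE[l1 l2]; apply: leq_trans (leq_ltn_trans le (ltnSn _)).
Qed.

(** * Balls of a network compared with balls of the limits *)

Section Neighbourhoods.
Variables (n : nat) (N : lnet n).
Notation V := 'I_(order N).
Hypothesis stc : simplex_tree_child N.
Variables (v : V) (r : nat).
Hypothesis zone : forall u, u \in ball r.+3 v -> regular u.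
Hypothesis sparse : forall u, u \in ball r.+1 v -> ~~ bad (2 * r.+1) u.

Lemma net_covering (X : mdigraph) (x0 : X) (f : X -> net_graph N) :
  f x0 = v -> (forall x, dist_le r.+1 x0 x -> local_iso f x) ->
  rmiso (ball_graph r x0) (@ball_graph r (net_graph N) v).
Proof.
move=> e loc.
have near_bad u : u \in @ball n N r.+1 (f x0) -> ~~ bad (2 * r.+1) u.
  by rewrite e; apply: sparse.
rewrite -e; apply: covering_iso loc _ _.
  by move=> y H; have : arc y y by []; rewrite (arc_irr stc).
move=> w l ll wl wA winj wB.
have wA' i : i < l -> @adj n N (w i) (w i.+1).
  by move=> /wA H; apply/orP.
have [i il] := cycle_bad stc ll wl wA' winj.
by apply/negP/near_bad/ballP/wB/ltnW.
Qed.

Lemma Lhat_ball : is_tree v ->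
  rmiso (ball_graph r Lhat_p0) (@ball_graph r (net_graph N) v).
Proof.
move=> tv.
have bP (b : unit) : is_tree v /\ v \in ball 0 v by rewrite ball_center.
apply: (@net_covering Lhat Lhat_p0 (@chart n N unit xpredT (fun=> v))) => // x dx.
apply: (@chart_local n N stc v r.+3 zone unit xpredT (fun=> v) 0 bP _ Lhat id) => //.
- by move=> y w; split=> [?|[u ->]] //; exists y.
- by move=> y w _; split=> [?|[u ->]] //; exists y.
- have := @dist_depth Lhat (@depth unit xpredT 0) _ (@depth_edge unit xpredT 0) _ _ dx.
  by rewrite add0n => le; apply: leq_trans le _; lia.
- by case: x dx => [[b|d] i|d|d].
Qed.

Section Reticulation.
(* [e] is 0 when the balls are centred at [rho], and 1 at its child. *)
Variables (rho p q : V) (e : nat).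
Hypotheses (le1 : e <= 1) (rr : is_retic rho) (rho_in : rho \in ball e v).
Hypotheses (pq : p != q) (pr : arc p rho) (qr : arc q rho).

Let base (b : bool) := if b then q else p.

Lemma base_spec b : is_tree (base b) /\ base b \in ball e.+1 v.
Proof.
rewrite /base; case: b; split;
  by [apply: (retic_parent stc rr)|apply: ball_step rho_in _; rewrite /adj ?pr ?qr orbT].
Qed.

Definition rchart (x : rvertex) : V :=
  match x with
  | Old w => @chart n N bool nz base w
  | Rho0 => rho
  | Ell0 => child rho
  end.

(** Distance to [Rho0] if [e] is 0, and to [Ell0] if [e] is 1. *)
Definition rdepth (x : rvertex) : nat :=
  match x with
  | Old w => depth e.+1 w
  | Rho0 => e
  | Ell0 => 1 - e
  end.

Lemma redge_in x y : redge x y <->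
  match y with
  | Old w => exists2 u, x = Old u & sedge u w
  | Rho0 => x = Old (SpineV (Base false) 0%R) \/ x = Old (SpineV (Base true) 0%R)
  | Ell0 => x = Rho0
  end.
Proof.
split; first by case=> [u w uw|[]|]; [exists u|right|left|].
case: y => [w [u -> uw]|[->|->]|->]; by constructor.
Qed.

Lemma redge_depth (x y : Rhat) : edge x y ->
  (rdepth x <= (rdepth y).+1) /\ (rdepth y <= (rdepth x).+1).
Proof.
case=> [u w uw|b|] /=; first exact: (depth_edge _ uw).
  by clear; lia.
by clear -le1; lia.
Qed.

Lemma arc_rho w : arc w rho = (w == p) || (w == q).
Proof.
apply: (@card2_predE _ [pred u | arc u rho]) => //.
by rewrite -[#|_|]/(indeg rho); case: (vtypeP stc rho) rr.
Qed.

Lemma rchart_local (x : Rhat) : rdepth x <= r.+3 ->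
  @local_iso Rhat (net_graph N) rchart x.
Proof.
have e1 : e.+1 <= r.+3 by lia.
have [ac lc oc] := child_spec stc rr.
case: x => [w|_|_] /=; last 2 first.
- apply: (@local_iso_intro n N Rhat rchart Rho0
    [:: Old (SpineV (Base false) 0%R); Old (SpineV (Base true) 0%R)] [:: Ell0]).
  + by rewrite /net_mark /=; case: (vtypeP stc rho) rr.
  + move=> y; rewrite /= redge_in; split; first by case=> ->; auto.
    by case=> [<-|[<-|//]]; auto.
  + move=> y /=; split.
      by move=> /redge_in; case: y => [w [u //]|[]//|]; left.
    by case=> // <-; constructor.
  + by move=> w; rewrite /= arc_rho !inE.
  + by move=> w; rewrite /= oc !inE.
  + rewrite /= !inE (negbTE pq) andbT /=.
    by rewrite !tree_neq_leaf // ?(retic_parent stc rr pr) ?(retic_parent stc rr qr).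
- apply: (@local_iso_intro n N Rhat rchart Ell0 [:: Rho0] [::]) => //.
  + by rewrite /net_mark /= lc.
  + by move=> y; rewrite /= redge_in; split; [auto|case].
  + move=> y /=; split=> // /redge_in.
    by case: y => [w [u //]|[]//|].
  + move=> w; rewrite /= !inE; apply/idP/eqP => [wc|->//].
    by apply: in_uniq wc ac; case: (vtypeP stc (child rho)) lc.
  + by move=> w; rewrite /= (leaf_out stc).
(* [chart_local] settles the recursive part except the positions 0 of the base spines, whose
   out-neighbours include [Rho0]; these are treated by hand. *)
move=> dw; have [|dec] := boolP (undecorated w); last first.
  apply: (@chart_local n N stc v r.+3 zone bool nz base e.+1 base_spec e1 Rhat Old) => //.
    by move=> y u; rewrite /= redge_in.
  move=> y u nu /=; split; last by case=> x -> ux; constructor.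
  move=> /redge_in; case: y => [x [x' [->]]|[] [eu]|//].
  - by exists x.
  - by move: nu; rewrite eu.
  - by move: nu; rewrite eu.
case: w dw => [[b|//] i||] //= dw; rewrite negbK => /eqP i0; rewrite {i}i0 in dw *.
have [tu ru eup edn] :=
  @chart_spine n N stc v r.+3 zone bool nz base e.+1 base_spec e1 (Base b) 0%R dw.
have [[tup tdn rh] [iu ad ah ou]] := regular_tree stc tu ru.
have eh : hyb (base b) = rho.
  by apply: (hybE stc _ rr); rewrite /base; case: (b).
apply: (@local_iso_intro n N Rhat rchart (Old (SpineV (Base b) 0%R))
  [:: Old (SpineV (Base b) (0 - 1)%R)] [:: Old (SpineV (Base b) (0 + 1)%R); Rho0]).
- by rewrite /net_mark /=; case: (vtypeP stc (base b)) tu.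
- move=> y; rewrite /= redge_in; split.
    by case=> u -> /sedge_ins[<-|//]; left.
  by case=> // <-; eexists; [reflexivity|apply/sedge_ins; left].
- move=> y /=; split.
    move=> /redge_in; case: y => [x|_|//]; last by auto.
    case=> u [<-] /sedge_ins; case: x => [s i|d|d] /=.
    + by case=> // -[-> <-]; left; rewrite subrK.
    + by case=> [|[//|//]]; case: d => [c j Dj|//] [_ j0]; move: Dj; rewrite j0.
    + by case.
  by case=> [<-|[<-|//]]; do ?constructor.
- by move=> w; rewrite /= iu !inE.
- by move=> w; rewrite /= ou !inE /= eh.
- change (uniq [:: up (base b); down (base b); rho]); rewrite /= !inE andbT.
  rewrite (negbTE (tree_neq_retic stc tup rr)) (tree_neq_retic stc tdn rr) orbF andbT.
  apply/negP => /eqP E; have : arc (base b) (up (base b)) by rewrite E.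
  by rewrite (arc_asym stc) // iu eqxx.
Qed.

Lemma Rhat_covering (x0 : Rhat) : rdepth x0 = 0 -> rchart x0 = v ->
  rmiso (ball_graph r x0) (@ball_graph r (net_graph N) v).
Proof.
move=> d0 c0; apply: (@net_covering Rhat x0 rchart) => // x dx.
apply: rchart_local; have := dist_depth redge_depth dx; rewrite d0; lia.
Qed.

End Reticulation.

Lemma two_parents_exist (rho : V) : is_retic rho ->
  exists p q, [/\ p != q, arc p rho & arc q rho].
Proof.
move=> rr; have /card_gt1P[p [q []]] : 1 < #|[pred u | arc u rho]|.
  by rewrite -[#|_|]/(indeg rho); case: (vtypeP stc rho) rr.
by rewrite !inE => pr qr pq; exists p, q.
Qed.

Lemma Rhat_ball : is_retic v ->
  rmiso (ball_graph r Rhat_rho0) (@ball_graph r (net_graph N) v).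
Proof.
move=> rv; have [p [q [pq pr qr]]] := two_parents_exist rv.
by apply: (@Rhat_covering v p q 0) => //; apply: ball_center.
Qed.

Lemma Nlf_ball : is_leaf v ->
  rmiso (ball_graph r Nlf_ell0) (@ball_graph r (net_graph N) v).
Proof.
move=> lv; have : ~~ defect v by apply/regular_self/zone/ball_center.
rewrite /defect /free_leaf lv !negb_or negbK => /and3P[_ /existsP[rho /andP[rr rv]] _].
have [p [q [pq pr qr]]] := two_parents_exist rr.
apply: (@Rhat_covering rho p q 1) => //.
  by apply: ball_step (ball_center 0 v) _; rewrite /adj rv orbT.
exact: childE.
Qed.

End Neighbourhoods.

(** * Convergence in probability *)

Lemma rmiso_sym (G H : rmdigraph) : rmiso G H -> rmiso H G.
Proof.
case=> f [[g fK gK] fe fm fr]; exists g; split; first by exists f.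
- by move=> x y; rewrite fe !gK.
- by move=> x; rewrite -fm gK.
- by rewrite -fr fK.
Qed.

Lemma rmiso_trans (G H K : rmdigraph) : rmiso G H -> rmiso H K -> rmiso G K.
Proof.
case=> f [bf fe fm fr] [g [bg ge gm gr]]; exists (g \o f); split.
- exact: bij_comp.
- by move=> x y /=; rewrite fe ge.
- by move=> x /=; rewrite gm fm.
- by rewrite /= fr gr.
Qed.

Lemma net_iso_class n (N M : lnet n) : net_iso N M -> iso_class N = iso_class M.
Proof.
move=> NM; have [f isof] : exists f, iso_map f := NM.
have [g isog _] := iso_map_inv isof.
apply/funext => L; apply/propext; split=> -[h isoh].
  by exists (h \o g); apply: iso_map_comp isog isoh.
by exists (h \o f); apply: iso_map_comp isof isoh.
Qed.

Section Representatives.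
Variables (R : realType) (n : nat) (A : set (lnet n)).
Let C := (@iso_class n @` @simplex_tree_child n)%classic.
Let CA := (@iso_class n @` (@simplex_tree_child n `&` A))%classic.

(* [fset_set] of an infinite set is empty and [x / 0 = 0]: thus the finiteness
   of the set of classes need not be proved. *)
Lemma unif_prob_infinite : ~ finite_set C -> unif_prob R A = 0%R.
Proof.
move=> infC; rewrite /unif_prob -/C; have -> : fset_set C = fset0.
  by rewrite /fset_set; case: pselect.
by rewrite cardfs0 invr0 mulr0.
Qed.

(* Each representative is taken in [A] if its class meets [A], so that [A] need
   not be invariant under isomorphism. *)
Lemma unif_prob_reps : finite_set C ->
  exists (T : finType) (rep : T -> lnet n),
  [/\ forall x, simplex_tree_child (rep x),
      forall N, simplex_tree_child N -> exists x, net_iso N (rep x),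
      forall x y, net_iso (rep x) (rep y) -> x = y
    & unif_prob R A = (#|[pred x | `[< A (rep x) >]]|%:R / #|T|%:R)%R].
Proof.
move=> finC.
have CAC : (CA `<=` C)%classic by move=> _ [N [sN _] <-]; exists N.
have finCA : finite_set CA by apply: sub_finite_set finC.
have inC (c : fset_set C) : C (val c).
  by have := valP c; rewrite in_fset_set // => /set_mem.
have ex (c : fset_set C) : exists N, [/\ simplex_tree_child N, iso_class N = val c
    & CA (val c) -> A N].
  have [[N [sN AN] e]|nCA] := pselect (CA (val c)); first by exists N.
  by have [N sN e] := inC c; exists N.
have [rep repP] := choice ex.
exists (fset_set C : finType), rep; split.
- by move=> x; have [] := repP x.
- move=> N sN; have cN : iso_class N \in fset_set C.
    by rewrite in_fset_set //; apply/mem_set; exists N.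
  exists [` cN]%fset; have [_ e _] := repP [` cN]%fset.
  have -> : net_iso N = iso_class (rep [` cN]%fset) by rewrite e.
  by exists id; split=> //; exists id.
- move=> x y /net_iso_class; have [_ -> _] := repP x; have [_ -> _] := repP y.
  exact: val_inj.
rewrite /unif_prob -/C -/CA; congr (_%:R / _%:R)%R; last by rewrite cardfE.
have sub : (fset_set CA `<=` fset_set C)%fset.
  by apply/fsubsetP => c; rewrite !in_fset_set // => /set_mem/CAC/mem_set.
rewrite -(card_fsub sub); apply: eq_card => c; rewrite !inE in_fset_set //.
have [sN e H] := repP c.
apply/idP/asboolP => [/set_mem/H //|Ac].
by apply/mem_set; exists (rep c).
Qed.

End Representatives.

(** * Typical vertices and the local frequencies *)

Section TypicalVertices.
Variables (n : nat) (N : lnet n) (r : nat).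
Notation V := 'I_(order N).

(** The radius is one more than that of the regular zone, because regularity itself inspects
    neighbours. *)
Definition typical (v : V) :=
  [forall u, (u \in ball r.+4 v) ==> ~~ (defect u || bad (2 * r.+1) u)].

Hypothesis stc : simplex_tree_child N.

Lemma typical_zone (v : V) : typical v ->
  (forall u, u \in ball r.+3 v -> regular u) /\
  (forall u, u \in ball r.+1 v -> ~~ bad (2 * r.+1) u).
Proof.
move=> /forallP tv; split=> u uv.
  apply/forallP => w; apply/implyP => wu.
  have /implyP := tv w; rewrite -addn1 (ball_trans uv wu) => /(_ isT).
  by rewrite negb_or => /andP[].
have le : r.+1 <= r.+4 by clear; lia.
have /implyP := tv u; rewrite (fintype.subsetP (ball_leq v le) _ uv) => /(_ isT).
by rewrite negb_or => /andP[].
Qed.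

(** One root, $J$ free leaves and $J - 1$ binary vertices. *)
Lemma card_defect : #|@defect n N| <= 2 * #|@free_leaf n N|.
Proof.
have cU (A B : pred V) : #|[predU A & B]| <= #|A| + #|B|.
  by rewrite -cardUI leq_addr.
have le3 : #|@defect n N| <= #|@is_root n N| + (#|@free_leaf n N| + #|@binary n N|).
  apply: leq_trans (leq_add (leqnn _) (cU _ _)); apply: leq_trans (cU _ _).
  by apply: subset_leq_card; apply/fintype.subsetP => v.
apply: leq_trans le3 _; rewrite (card_root stc) addnCA (addnC 1).
by rewrite (card_binary stc) mul2n addnn.
Qed.

Lemma card_atypical : #|[pred v : V | ~~ typical v]| <=
  (2 * #|@free_leaf n N| + #|@bad n N (2 * r.+1)|) * 4 ^ r.+4.
Proof.
pose Z := [set u : V | defect u || bad (2 * r.+1) u]%SET.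
have cZ : #|Z| <= 2 * #|@free_leaf n N| + #|@bad n N (2 * r.+1)|.
  apply: leq_trans (leq_add card_defect (leqnn _)).
  rewrite -cardUI cardsE; apply: leq_trans (leq_addr _ _).
  by apply: subset_leq_card; apply/fintype.subsetP => v.
apply: leq_trans (leq_mul cZ (leqnn _)).
apply: leq_trans (card_near stc Z r.+4).
apply: subset_leq_card; apply/fintype.subsetP => v.
rewrite !inE negb_forall => /existsP[u]; rewrite negb_imply negbK => /andP[uv uZ].
by apply/exists_inP; exists u; rewrite // inE.
Qed.

(** Typical vertices in [P] all have the neighbourhood of the limit, so all of them match [G] or
    none does; only atypical vertices contribute to the error. *)
Lemma local_freq_typical (R : realType) (P : pred V) (X : mdigraph) (x0 : X)
    (G : rmdigraph) :
  (forall v, P v -> typical v ->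
     rmiso (ball_graph r x0) (@ball_graph r (net_graph N) v)) ->
  0 < #|[pred v | P v]| ->
  (`|local_freq R P r G - det_prob R r x0 G| * #|[pred v | P v]|%:R
     <= #|[pred v | ~~ typical v]|%:R :> R)%R.
Proof.
move=> loc P0; rewrite /local_freq.
set c := #|[pred v | P v]| in P0 *.
set Q := [pred u | P u && `[< rmiso (@ball_graph r (net_graph N) u) G >]].
have c0 : (c%:R != 0 :> R)%R by rewrite pnatr_eq0 -lt0n.
rewrite -[X in (_ * X)%R]normr_nat -normrM mulrBl divfK // /det_prob.
have [isoG|nisoG] := pselect (rmiso (ball_graph r x0) G).
  rewrite asboolT // mul1r.
  have cQ : #|Q| + #|[pred v | P v && ~~ `[< rmiso (@ball_graph r (net_graph N) v) G >]]| = c.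
    rewrite /c -(cardID (fun u => `[< rmiso (@ball_graph r (net_graph N) u) G >]) [pred v | P v]).
    by congr (_ + _); apply: eq_card => v; rewrite !inE // andbC.
  rewrite -cQ natrD opprD addNKr normrN normr_nat ler_nat.
  apply: subset_leq_card; apply/fintype.subsetP => v; rewrite !inE.
  case/andP=> Pv; apply: contra => tv; apply/asboolP.
  exact: rmiso_trans (rmiso_sym (loc v Pv tv)) isoG.
rewrite asboolF // mul0r subr0 normr_nat ler_nat.
apply: subset_leq_card; apply/fintype.subsetP => v; rewrite !inE.
case/andP=> Pv /asboolP iG; apply: contra_notN nisoG => tv.
exact: rmiso_trans (loc v Pv tv) iG.
Qed.

End TypicalVertices.

(** Markov's inequality, in terms of cardinals. *)
Lemma card_mul_le (T : finType) (X : {pred T}) (F : T -> nat) M B :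
  \sum_x F x <= B -> {in X, forall x, M <= F x} -> #|X| * M <= B.
Proof.
move=> FB XM; apply: leq_trans FB; rewrite -sum_nat_const big_mkcond /=.
by apply: leq_sum => x _; case: ifP => // /XM.
Qed.

(** * Tail bounds from the two switchings *)

Section Counting.
Variables (n : nat) (T : finType) (rep : T -> lnet n).
Hypothesis rep_stc : forall x, simplex_tree_child (rep x).
Hypothesis rep_onto :
  forall N, simplex_tree_child N -> exists x, net_iso N (rep x).
Hypothesis rep_inj : forall x y, net_iso (rep x) (rep y) -> x = y.

Lemma regraft_count :
  \sum_x #|@binary n (rep x)| * #|@free_leaf n (rep x)| <= #|T| * (4 * n * 4 ^ 1).
Proof.
have count := @surgery_count n T rep rep_stc rep_onto rep_inj
  (fun N b y => binary b && free_leaf y) 1 (@regraft_surgery n) _ (@regraft_surgeryK n).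
apply: leq_trans (count _).
  by apply: leq_sum => x _; rewrite -cardX; apply: subset_leq_card; apply/fintype.subsetP.
move=> N b y stc /andP[bb fy].
have [c bc cy] := incomparable_child stc bb fy.
have [p py] : exists p, arc p y by apply: (leaf_in stc); case/andP: fy.
exists (regraft_net b c p y), (enum_rank (Some None)), (enum_rank None); split.
- exact: regraft_stc.
- exact: regraft_near.
- exists c, p; split=> //; first exact: regraft_cNy cy.
  by exists id; split=> //; split=> //; exists id.
Qed.

Lemma swap_count L :
  \sum_x #|@bad n (rep x) L| * (#|@is_retic n (rep x)| * 2 - 4 ^ L) <=
  #|T| * (4 * n * 4 ^ L.+2).
Proof.
have count := @surgery_count n T rep rep_stc rep_onto rep_inj
  (fun N u v => [&& bad L u, unary v & v \notin ball L u]) L.+2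
  (@swap_surgery n) _ (@swap_surgeryK n).
apply: leq_trans (count _).
  by apply: leq_sum => x _; apply: card_swap_pairs.
move=> N u v stc /and3P[bu uv vu]; have uu := bad_unary stc bu.
exists (swap_net u v), u, v; split.
- exact: swap_stc.
- exact: swap_near.
- by split=> //; exists id; split=> //; split=> //; exists id.
Qed.

Lemma many_free_leaves d : 0 < d -> 2 * d <= n -> 0 < n ->
  #|[pred x | n < d * #|@free_leaf n (rep x)|]| * n <= 32 * d ^ 2 * #|T|.
Proof.
move=> d0 dn n0; rewrite -(leq_pmul2r n0) -mulnA.
rewrite (_ : 32 * d ^ 2 * #|T| * n = 2 * d ^ 2 * (#|T| * (4 * n * 4 ^ 1))); last first.
  by clear; rewrite expn1; lia.
apply: (@card_mul_le T _ (fun x => 2 * d ^ 2 * (#|@binary n (rep x)| * #|@free_leaf n (rep x)|))).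
  by rewrite -big_distrr /= leq_mul2l regraft_count orbT.
move=> x; rewrite inE => nJ; have eJ := card_binary (rep_stc x).
(* From $n < dJ$ and $2d \le n$ follows $d (J - 1) \ge n / 2$. Hence $2 d^2 (J - 1) J \ge n^2$, the
   lower bound for Markov's inequality. *)
have nb : n <= 2 * d * #|@binary n (rep x)|.
  rewrite -eJ mulnDr muln1 in nJ; rewrite -mulnA.
  by move: nJ dn; move: (d * _) => t; clear; lia.
apply: (@leq_trans ((2 * d * #|@binary n (rep x)|) * (d * #|@free_leaf n (rep x)|))).
  by apply: leq_mul => //; apply: ltnW.
by clear; rewrite -mulnn; lia.
Qed.

Lemma many_bad d L : 3 < d -> 2 * 4 ^ L <= n -> 0 < n ->
  #|[pred x | (d * #|@free_leaf n (rep x)| <= n) && (n < d * #|@bad n (rep x) L|)]|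
    * n <= d * 4 ^ L.+3 * #|T|.
Proof.
move=> d3 Ln n0; rewrite -(leq_pmul2r n0) -mulnA.
rewrite (_ : d * 4 ^ L.+3 * #|T| * n = d * (#|T| * (4 * n * 4 ^ L.+2))); last first.
  by clear; rewrite (expnS 4 L.+2); lia.
apply: (@card_mul_le T _
  (fun x => d * (#|@bad n (rep x) L| * (#|@is_retic n (rep x)| * 2 - 4 ^ L)))).
  by rewrite -big_distrr /= leq_mul2l swap_count orbT.
move=> x; rewrite inE => /andP[dJ db]; have eJ := card_free_leaf (rep_stc x).
rewrite mulnA; apply: leq_mul; first exact: ltnW.
(* As $d \ge 4$, at most $n / 4$ leaves are free, so twice the number of reticulations is at least
   $3n / 2$; subtracting $4^L \le n / 2$ leaves at least $n$. *)
have : 4 * #|@free_leaf n (rep x)| <= n by apply: leq_trans dJ; apply: leq_mul.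
move: eJ Ln; move: #|@free_leaf n (rep x)| #|@is_retic n (rep x)| (4 ^ L) => a b c.
by clear; lia.
Qed.

End Counting.

Local Open Scope ring_scope.

(** Union bound: either there are many free leaves, or there are few of them and many bad
    vertices. *)
Lemma unif_prob_rare (R : realType) (n d L : nat) (A : set (lnet n)) :
  (3 < d)%N -> (2 * d <= n)%N -> (2 * 4 ^ L <= n)%N -> (0 < n)%N ->
  (forall N, simplex_tree_child N -> A N ->
     (n < d * #|@free_leaf n N|)%N \/ (n < d * #|@bad n N L|)%N) ->
  0 <= unif_prob R A /\
  unif_prob R A * n%:R <= (32 * d ^ 2 + d * 4 ^ L.+3)%N%:R.
Proof.
move=> d3 dn Ln n0 AP.
have [finC|infC] := pselect (finite_set (@iso_class n @` @simplex_tree_child n)%classic); last first.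
  by rewrite unif_prob_infinite // mul0r lexx; split=> //; rewrite ler0n.
have [T [rep [rs ro ri ->]]] := unif_prob_reps R A finC.
split; first by apply: divr_ge0; rewrite ler0n.
have [T0|T0] := eqVneq #|T| 0%N.
  by rewrite T0 invr0 mulr0 mul0r ler0n.
rewrite mulrAC ler_pdivrMr ?ltr0n ?lt0n // -!natrM ler_nat mulnDl.
apply: leq_trans (leq_add (many_free_leaves rs ro ri (ltnW (ltnW (ltnW d3))) dn n0)
                          (many_bad rs ro ri d3 Ln n0)).
rewrite -mulnDl leq_mul2r; apply/orP; right.
rewrite -cardUI; apply: leq_trans (leq_addr _ _).
apply: subset_leq_card; apply/fintype.subsetP => x; rewrite !inE => /asboolP Ax.
by have [->//|bx] := AP _ (rs x) Ax; case: ltnP.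
Qed.

Section Convergence.
Variables (R : realType) (r : nat) (G : rmdigraph).
Variables (P : forall n (N : lnet n), pred 'I_(Defs.order N)).
Variables (X : mdigraph) (x0 : X).
Hypothesis P_local : forall n (N : lnet n) v, simplex_tree_child N -> P v ->
  typical r v -> rmiso (ball_graph r x0) (@ball_graph r (net_graph N) v).
Hypothesis P_many : forall n (N : lnet n), simplex_tree_child N -> (1 < n)%N ->
  (2 * #|@free_leaf n N| <= n)%N -> (n <= 2 * #|[pred v | @P n N v]|)%N.

Lemma local_freq_cvg :
  cvg_in_prob (fun n N => local_freq R (@P n N) r G) (det_prob R r x0 G).
Proof.
move=> e e0; pose L := (2 * r.+1)%N; pose W := (4 ^ r.+4)%N.
(* If free leaves and bad vertices both number at most [n / d], at most [3 * n * W / d] vertices are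
   atypical, against at least [n / 2] vertices in [P]; the ratio [6 * W / d] must not exceed [e].
   The summand 4 ensures [3 < d]. *)
pose d := (Num.bound (6 * W%:R / e) + 4)%N.
have dP : 6 * W%:R <= e * d%:R.
  rewrite [e * _]mulrC -ler_pdivrMr //; apply: le_trans (ltW (archi_boundP _)) _.
    by rewrite divr_ge0 ?mulr_ge0 ?ler0n // ltW.
  by rewrite ler_nat leq_addr.
pose Cst := (32 * d ^ 2 + d * 4 ^ L.+3)%N.
apply/cvgrPdist_le => eps eps0.
(* The last term makes [Cst / n] at most [eps]; the others are the conditions of
   [unif_prob_rare]. *)
exists (maxn (maxn (2 * d) (2 * 4 ^ L)) (Num.bound (Cst%:R / eps))) => // n /=.
rewrite !geq_max => /andP[/andP[dn Ln] Cn].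
have n1 : (1 < n)%N by apply: leq_trans dn; rewrite /d; lia.
have n0 : (0 < n)%N by apply: ltnW.
have d3 : (3 < d)%N by rewrite /d; clear; lia.
set far := [set N : lnet n | _]%classic.
have farP N : simplex_tree_child N -> far N ->
    (n < d * #|@free_leaf n N|)%N \/ (n < d * #|@bad n N L|)%N.
  move=> stc /= farN; apply/orP; apply: contraT; rewrite negb_or -!leqNgt.
  case/andP=> dJ db; have J2 : (2 * #|@free_leaf n N| <= n)%N.
    by apply: leq_trans dJ; apply: leq_mul => //; apply: ltnW (ltnW d3).
  have Pn := P_many stc n1 J2.
  have P0 : (0 < #|[pred v | @P n N v]|)%N by move: Pn n0; clear; lia.
  have close := local_freq_typical R G (fun v Pv tv => P_local stc Pv tv) P0.
  have few : (d * #|[pred v | ~~ @typical n N r v]| <= 3 * n * W)%N.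
    apply: leq_trans (leq_mul (leqnn d) (card_atypical r stc)) _.
    rewrite mulnA leq_mul2r; apply/orP; right.
    by rewrite mulnDr mulnCA; move: dJ db; rewrite -/L; clear; lia.
  (* A deviation above [e] would need more atypical vertices than [few] allows, by [dP] and [Pn]. *)
  have : (e * d%:R) * #|[pred v | @P n N v]|%:R < (3 * n * W)%N%:R :> R.
    apply: (@lt_le_trans _ _ (d * #|[pred v | ~~ @typical n N r v]|)%N%:R).
      rewrite [e * _]mulrC -mulrA natrM ltr_pM2l ?ltr0n ?(leq_trans _ d3) //.
      by apply: lt_le_trans close; rewrite ltr_pM2r // ltr0n.
    by rewrite ler_nat.
  rewrite ltNge => /negP[].
  apply: (@le_trans _ _ (6 * W%:R * #|[pred v | @P n N v]|%:R)); last first.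
    by rewrite ler_pM2r // ltr0n.
  by rewrite -!natrM ler_nat; move: Pn; clear; nia.
have [p0 pn] := unif_prob_rare R d3 dn Ln n0 farP.
rewrite sub0r normrN ger0_norm //.
rewrite -(@ler_pM2r _ n%:R) ?ltr0n //; apply: le_trans pn _.
rewrite [eps * _]mulrC -ler_pdivrMr //; apply: le_trans (ltW (archi_boundP _)) _.
  by rewrite divr_ge0 ?ler0n // ltW.
by rewrite ler_nat.
Qed.

End Convergence.

Theorem theorem1p11 (R : realType) (r : nat) (G : rmdigraph)
    (finG : finite_set [set: G]%classic) :
  [/\ @cvg_in_prob R (fun n N => local_freq R (@is_tree n N) r G)
        (det_prob R r Lhat_p0 G),
      @cvg_in_prob R (fun n N => local_freq R (@is_retic n N) r G)
        (det_prob R r Rhat_rho0 G)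
    & @cvg_in_prob R (fun n N => local_freq R (@is_leaf n N) r G)
        (det_prob R r Nlf_ell0 G)].
Proof.
split; apply: local_freq_cvg.
- by move=> n N v stc tv /typical_zone[z s]; apply: Lhat_ball.
(* With at most [n / 2] free leaves there are at least [n / 2] reticulations, and the tree vertices
   outnumber the reticulations by [n - 1]. *)
- move=> n N stc n1 J2; have := card_tree stc; have := card_free_leaf stc.
  rewrite -[#|[pred v | is_tree v]|]/#|@is_tree n N|; lia.
- by move=> n N v stc tv /typical_zone[z s]; apply: Rhat_ball.
- move=> n N stc n1 J2; have := card_free_leaf stc.
  rewrite -[#|[pred v | is_retic v]|]/#|@is_retic n N|; lia.
- by move=> n N v stc tv /typical_zone[z s]; apply: Nlf_ball.
- move=> n N stc n1 J2; rewrite -[#|[pred v | is_leaf v]|]/#|@is_leaf n N|.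
  rewrite (card_leaf stc); lia.
Qed.
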